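(* Let $\mathbf{x}(0)=\mathbf{x}_0\in\mathbb{R}^n$ be the initial condition of the control-affine dynamical system $\dot{\mathbf{x}}=\mathbf{f}(\mathbf{x})+\mathbf{g}(\mathbf{x})\mathbf{u}$, $\mathbf{y}=\mathbf{h}(\mathbf{x})$, and let the system's nonlinear balancing transformation be approximated in polynomial form as $$\mathbf{x}=\bar{\boldsymbol{\Phi}}(\bar{\mathbf{z}})=\bar{\mathbf{T}}_1\bar{\mathbf{z}}+\bar{\mathbf{T}}_2\bar{\mathbf{z}}^{\otimes2}+\bar{\mathbf{T}}_3\bar{\mathbf{z}}^{\otimes3}+\cdots,\qquad \bar{\mathbf{T}}_k\in\mathbb{R}^{n\times n^k},$$ with $\bar{\mathbf{T}}_1$ invertible. Then the initial condition in the balanced realization is $\bar{\mathbf{z}}(0)=\bar{\mathbf{z}}_0=\bar{\boldsymbol{\Phi}}^{-1}(\mathbf{x}_0)$, where the inverse balancing transformation is locally approximated by $$\bar{\mathbf{z}}=\bar{\boldsymbol{\Phi}}^{-1}(\mathbf{x})=\mathbf{P}_1\mathbf{x}+\mathbf{P}_2\mathbf{x}^{\otimes2}+\mathbf{P}_3\mathbf{x}^{\otimes3}+\cdots,$$ where $\mathbf{P}_1=\bar{\mathbf{T}}_1^{-1}$ and the remaining coefficients, for $i\ge2$, are given recursively by $$\mathbf{P}_i=\Big(-\sum_{j=1}^{i-1}\mathbf{P}_j\,\bar{\mathcal{T}}_{j,i}\Big)\mathbf{P}_1^{\otimes i},$$ with $\bar{\mathcal{T}}_{j,i}$ the sum of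 all unique tensor products of the $\bar{\mathbf{T}}_k$ with $j$ factors and $n^i$ columns.
   Context: Kronecker notation. $\otimes$ is the Kronecker product; $\mathbf{x}^{\otimes k}=\mathbf{x}\otimes\cdots\otimes\mathbf{x}$ ($k$ factors), and likewise $\mathbf{P}_1^{\otimes i}$ is the $i$-fold Kronecker product of the matrix $\mathbf{P}_1$. Given $\bar{\mathbf{T}}_k\in\mathbb{R}^{n\times n^k}$ ($k\ge1$), the sum of all unique tensor products with $p\ge1$ factors and $n^q$ columns is $$\bar{\mathcal{T}}_{p,q}=\sum_{i_1+\cdots+i_p=q,\; i_1,\dots,i_p\ge1}\bar{\mathbf{T}}_{i_1}\otimes\cdots\otimes\bar{\mathbf{T}}_{i_p}\in\mathbb{R}^{n^p\times n^q},$$ over ordered $p$-tuples of positive integers. Series convention. All expansions are power series about the origin, with series taken to infinity. ''Locally approximated by'' a series means that for each $k$ the homogeneous degree-$k$ part of the Taylor expansion at the origin of the function is the $k$-th term of the series (truncating at a finite degree gives an approximation near the origin). $\bar{\boldsymbol{\Phi}}^{-1}$ denotes the local inverse of $\bar{\boldsymbol{\Phi}}$ near the origin, and $\mathbf{x}_0$ is understood to lie in the neighborhood where it is defined. Setting. The system has $\mathbf{x}\in\mathbb{R}^n$, $\mathbf{u}\in\mathbb{R}^m$, $\mathbf{y}\in\mathbb{R}^p$, and its Jacobian linearization at the origin is minimal, asymptotically stable, and has distinct Hankel singular values. The energy functions, assumed to exist, be finite, and be smooth near the origin, are $$\mathcal{E}_c(\mathbf{x}_0)=\min_{\mathbf{u}\in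 L_2(-\infty,0),\ \mathbf{x}(-\infty)=0,\ \mathbf{x}(0)=\mathbf{x}_0}\tfrac12\int_{-\infty}^0\|\mathbf{u}(t)\|^2dt,\qquad \mathcal{E}_o(\mathbf{x}_0)=\tfrac12\int_0^\infty\|\mathbf{y}(t)\|^2dt\ \text{ with }\mathbf{x}(0)=\mathbf{x}_0,\ \mathbf{u}\equiv0.$$ A balancing transformation is a smooth coordinate transformation $\mathbf{x}=\bar{\boldsymbol{\Phi}}(\bar{\mathbf{z}})$ near the origin, $\bar{\boldsymbol{\Phi}}(0)=0$, such that for some functions $\bar\sigma_i$ (the singular value functions) $$\mathcal{E}_c(\bar{\boldsymbol{\Phi}}(\bar{\mathbf{z}}))=\tfrac12\sum_{i=1}^n\frac{\bar z_i^2}{\bar\sigma_i(\bar z_i)},\qquad \mathcal{E}_o(\bar{\boldsymbol{\Phi}}(\bar{\mathbf{z}}))=\tfrac12\sum_{i=1}^n\bar z_i^2\,\bar\sigma_i(\bar z_i).$$ The balanced realization is the system rewritten in the coordinates $\bar{\mathbf{z}}$: $\dot{\bar{\mathbf{z}}}=\big[\partial\bar{\boldsymbol{\Phi}}(\bar{\mathbf{z}})/\partial\bar{\mathbf{z}}\big]^{-1}\big(\mathbf{f}(\bar{\boldsymbol{\Phi}}(\bar{\mathbf{z}}))+\mathbf{g}(\bar{\boldsymbol{\Phi}}(\bar{\mathbf{z}}))\mathbf{u}\big)$, $\mathbf{y}=\mathbf{h}(\bar{\boldsymbol{\Phi}}(\bar{\mathbf{z}}))$; the Jacobian is assumed invertible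 near the origin. *)

(* Defs.v *)
From mathcomp Require Import all_boot all_order all_algebra.
From mathcomp Require Import all_classical all_reals all_analysis.
From mathcomp Require Export mxtens.

Set Implicit Arguments.
Unset Strict Implicit.
Unset Printing Implicit Defensive.

Import Order.TTheory GRing.Theory Num.Theory.
Import numFieldNormedType.Exports.
Local Open Scope classical_set_scope.
Local Open Scope ring_scope.

Section Kronecker.
Variables (R : realType) (n : nat).

(* [^t] is the iterated Kronecker product of mxtens; the cast only replaces
   the column count [1 ^ k] by [1]. *)
Definition kron_pow (x : 'cV[R]_n) (k : nat) : 'cV[R]_(n ^ k) :=
  castmx (erefl, exp1n k) (x ^t k).

Variable T : forall k : nat, 'M[R]_(n, n ^ k).

(* T_(i_1) (x) ... (x) T_(i_p) for s = [:: i_1; ...; i_p]. *)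
Fixpoint kron_seq (s : seq nat) : 'M[R]_(n ^ size s, n ^ sumn s) :=
  match s with
  | [::] => 1%:M
  | i :: s' =>
      castmx (esym (expnS n (size s')), esym (expnD n i (sumn s')))
             (T i *t kron_seq s')
  end.

(* The parts i_1, ..., i_p of q are at most q, hence the range ['I_q.+1].
   In each summand the two dimensions agree, so [conform_mx] acts as a cast
   and its default value 0 is never used. *)
Definition tensor_sum (p q : nat) : 'M[R]_(n ^ p, n ^ q) :=
  \sum_(c : p.-tuple 'I_q.+1
          | all (fun i : 'I_q.+1 => (0 < i)%N) c
            && (sumn [seq val i | i <- c] == q))
     conform_mx 0 (kron_seq [seq val i | i <- c]).

Definition inverse_coefficients (P : forall k : nat, 'M[R]_(n, n ^ k)) : Prop :=
  P 1%N = invmx (T 1%N : 'M[R]_n) /\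
  forall i : nat, (2 <= i)%N ->
    P i = (- \sum_(1 <= j < i) P j *m tensor_sum j i) *m ((P 1%N : 'M[R]_n) ^t i).

End Kronecker.

Section Smoothness.
Variables (R : realType) (n : nat).

Definition iter_derive (W : normedModType R) (vs : seq 'cV[R]_n)
    (F : 'cV[R]_n -> W) : 'cV[R]_n -> W :=
  foldr (fun v G => 'D_v G) F vs.

(* C^oo on an open set A: all iterated directional derivatives are (Frechet)
   differentiable, hence continuous, at every point of A. *)
Definition smooth_on (W : normedModType R) (A : set 'cV[R]_n)
    (F : 'cV[R]_n -> W) : Prop :=
  forall x, A x -> forall vs, differentiable (iter_derive vs F) x.

Definition smooth_near0 (W : normedModType R) (F : 'cV[R]_n -> W) : Prop :=
  \forall x \near (0 : 'cV[R]_n), forall vs, differentiable (iter_derive vs F) x.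

(* D^k F(0)[x, ..., x] / k! *)
Definition taylor_part (W : normedModType R) (k : nat) (F : 'cV[R]_n -> W)
    (x : 'cV[R]_n) : W :=
  (k`!%:R)^-1 *: iter_derive (nseq k x) F 0.

(* F(x) = T_1 x + T_2 x^(x)2 + ... locally; T 0 plays no role, the series has
   no constant term. *)
Definition approximated_by (F : 'cV[R]_n -> 'cV[R]_n)
    (T : forall k : nat, 'M[R]_(n, n ^ k)) : Prop :=
  [/\ smooth_near0 F, F 0 = 0 &
      forall k x, (1 <= k)%N -> taylor_part k F x = T k *m kron_pow x k].

(* The matrix of partial derivatives on column vectors (the library's
   [jacobian] is for row vectors). *)
Definition jacobian_mx (p : nat) (F : 'cV[R]_n -> 'cV[R]_p) (x : 'cV[R]_n) :
    'M[R]_(p, n) :=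
  \matrix_(i, j) ('D_(delta_mx j 0) F x) i 0.

(* Psi is the inverse of Phi restricted to U, with U and V = Phi(U) open
   neighborhoods of the origin and Phi smooth with invertible Jacobian on U. *)
Definition local_inverse (Phi Psi : 'cV[R]_n -> 'cV[R]_n)
    (U V : set 'cV[R]_n) : Prop :=
  [/\ open U /\ U 0, open V /\ V 0,
      smooth_on U Phi /\ (forall z, U z -> jacobian_mx Phi z \in unitmx),
      (forall z, U z -> V (Phi z) /\ Psi (Phi z) = z) &
      (forall x, V x -> U (Psi x) /\ Phi (Psi x) = x)].

End Smoothness.

Section LinearSystems.
Variable R : realType.
Local Notation mu := (@lebesgue_measure R).

(* e^(t A), entrywise. *)
Definition expmx (n : nat) (A : 'M[R]_n) (t : R) : 'M[R]_n :=
  \matrix_(i, j) limn (series (fun k => t ^+ k / k`!%:R * (A ^+ k) i j)).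

(* No realization of the same impulse response has a smaller state space. *)
Definition minimal_realization (n m p : nat)
    (A : 'M[R]_n) (B : 'M[R]_(n, m)) (C : 'M[R]_(p, n)) : Prop :=
  forall (r : nat) (A' : 'M[R]_r) (B' : 'M[R]_(r, m)) (C' : 'M[R]_(p, r)),
    (forall t : R, 0 <= t -> C' *m expmx A' t *m B' = C *m expmx A t *m B) ->
    (n <= r)%N.

Definition asymptotically_stable (n : nat) (A : 'M[R]_n) : Prop :=
  (forall e : R, 0 < e -> exists2 d : R, 0 < d &
     forall x : 'cV[R]_n, `|x| < d -> forall t : R, 0 <= t -> `|expmx A t *m x| < e)
  /\ (forall x : 'cV[R]_n, expmx A t *m x @[t --> +oo] --> (0 : 'cV[R]_n)).

Definition ctrl_gramian (n m : nat) (A : 'M[R]_n) (B : 'M[R]_(n, m)) : 'M[R]_n :=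
  \matrix_(i, j)
    \int[mu]_(t in `[0, +oo[) (expmx A t *m B *m B^T *m (expmx A t)^T) i j.

Definition obs_gramian (n p : nat) (A : 'M[R]_n) (C : 'M[R]_(p, n)) : 'M[R]_n :=
  \matrix_(i, j)
    \int[mu]_(t in `[0, +oo[) ((expmx A t)^T *m C^T *m C *m expmx A t) i j.

(* The s i are the square roots of the eigenvalues, with multiplicity, of the
   product of the Gramians. *)
Definition hankel_singular_values (n m p : nat) (A : 'M[R]_n)
    (B : 'M[R]_(n, m)) (C : 'M[R]_(p, n)) (s : 'I_n -> R) : Prop :=
  (forall i, 0 <= s i) /\
  char_poly (ctrl_gramian A B *m obs_gramian A C)
    = \prod_(i < n) ('X - ((s i) ^+ 2)%:P).

End LinearSystems.

(* x' = f(x) + g(x) u, y = h(x) *)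
Record control_affine (R : realType) (n m p : nat) := ControlAffine {
  sys_f : 'cV[R]_n -> 'cV[R]_n;
  sys_g : 'cV[R]_n -> 'M[R]_(n, m);
  sys_h : 'cV[R]_n -> 'cV[R]_p }.

Section ControlAffineSystems.
Variables (R : realType) (n m p : nat).
Local Notation mu := (@lebesgue_measure R).
Local Notation system := (control_affine R n m p).

(* The origin is an equilibrium with zero output, and the Jacobian
   linearization there exists. *)
Definition linearizable (S : system) : Prop :=
  [/\ sys_f S 0 = 0, sys_h S 0 = 0, differentiable (sys_f S) 0,
      differentiable (sys_h S) 0 & {for 0, continuous (sys_g S)}].

Definition lin_A (S : system) : 'M[R]_n := jacobian_mx (sys_f S) 0.
Definition lin_B (S : system) : 'M[R]_(n, m) := sys_g S 0.
Definition lin_C (S : system) : 'M[R]_(p, n) := jacobian_mx (sys_h S) 0.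

Definition standing_assumptions (S : system) : Prop :=
  [/\ linearizable S,
      minimal_realization (lin_A S) (lin_B S) (lin_C S),
      asymptotically_stable (lin_A S) &
      exists2 s : 'I_n -> R,
        hankel_singular_values (lin_A S) (lin_B S) (lin_C S) s & injective s].

(* Caratheodory solutions on the interval I: inputs are only assumed to be
   measurable, so the differential equation is meant in integrated form. *)
Definition trajectory (S : system) (I : set R) (u : R -> 'cV[R]_m)
    (x : R -> 'cV[R]_n) : Prop :=
  let rhs t := sys_f S (x t) + sys_g S (x t) *m u t in
  forall s t : R, I s -> I t -> s <= t -> forall i : 'I_n,
    mu.-integrable `[s, t] (EFin \o (fun r => rhs r i 0)) /\
    x t i 0 - x s i 0 = \int[mu]_(r in `[s, t]) rhs r i 0.

Definition sqnorm (k : nat) (v : 'cV[R]_k) : R := \sum_(i < k) (v i 0) ^+ 2.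

Definition L2_past (u : R -> 'cV[R]_m) : Prop :=
  (forall i : 'I_m, measurable_fun (`]-oo, 0[%classic : set (measurableTypeR R)) (fun t => u t i 0)) /\
  mu.-integrable `]-oo, 0[ (EFin \o (fun t => sqnorm (u t))).

Definition ctrl_costs (S : system) (x0 : 'cV[R]_n) : set R :=
  [set e | exists u x,
     [/\ L2_past u, trajectory S `]-oo, 0] u x,
         x t @[t --> -oo] --> (0 : 'cV[R]_n), x 0 = x0 &
         e = 2^-1 * \int[mu]_(t in `]-oo, 0[) sqnorm (u t)]].

Definition ctrl_energy (S : system) (x0 : 'cV[R]_n) (e : R) : Prop :=
  ctrl_costs S x0 e /\ lbound (ctrl_costs S x0) e.

Definition obs_energy (S : system) (x0 : 'cV[R]_n) (e : R) : Prop :=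
  let free x := trajectory S `[0, +oo[ (fun=> 0) x /\ x 0 = x0 in
  (exists x, free x) /\
  forall x, free x ->
    mu.-integrable `[0, +oo[ (EFin \o (fun t => sqnorm (sys_h S (x t)))) /\
    e = 2^-1 * \int[mu]_(t in `[0, +oo[) sqnorm (sys_h S (x t)).

Definition energy_functions (S : system) (Ec Eo : 'cV[R]_n -> R) : Prop :=
  [/\ \forall x \near (0 : 'cV[R]_n), ctrl_energy S x (Ec x),
      \forall x \near (0 : 'cV[R]_n), obs_energy S x (Eo x),
      smooth_near0 (Ec : 'cV[R]_n -> R^o) & smooth_near0 (Eo : 'cV[R]_n -> R^o)].

(* [sigma i (z i 0) != 0] makes the quotient in the first identity meaningful. *)
Definition balancing_transformation (Ec Eo : 'cV[R]_n -> R)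
    (Phi : 'cV[R]_n -> 'cV[R]_n) : Prop :=
  [/\ smooth_near0 Phi, Phi 0 = 0,
      \forall z \near (0 : 'cV[R]_n), jacobian_mx Phi z \in unitmx &
      exists sigma : 'I_n -> R -> R, \forall z \near (0 : 'cV[R]_n),
        [/\ forall i : 'I_n, sigma i ((z : 'cV[R]_n) i 0) != 0,
            Ec (Phi z) = 2^-1 * \sum_(i < n) (z i 0) ^+ 2 / sigma i (z i 0) &
            Eo (Phi z) = 2^-1 * \sum_(i < n) (z i 0) ^+ 2 * sigma i (z i 0)]].

Definition balanced_realization (S : system) (Phi : 'cV[R]_n -> 'cV[R]_n) :
    system :=
  {| sys_f := fun z => invmx (jacobian_mx Phi z) *m sys_f S (Phi z);
     sys_g := fun z => invmx (jacobian_mx Phi z) *m sys_g S (Phi z);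
     sys_h := fun z => sys_h S (Phi z) |}.

End ControlAffineSystems.

(* Main.v *)
Require Import Defs.
From mathcomp Require Import all_boot all_order all_algebra.
From mathcomp Require Import all_classical all_reals all_analysis.
From mathcomp Require Import ring lra.
From HB Require Import structures.
Import Order.TTheory GRing.Theory Num.Theory.
Import numFieldNormedType.Exports.
Local Open Scope classical_set_scope.
Local Open Scope ring_scope.
Set Implicit Arguments.
Unset Strict Implicit.
Unset Printing Implicit Defensive.

(** The statement has two halves.

    The initial condition. Phi is smooth with invertible Jacobian near the
    origin, so the inverse function theorem provides a local inverse Psi
    (local_inverse_exists).  A curve x = Phi(z) is a Caratheodory solution of
    the original system exactly when z solves the balanced one: each direction
    is the chain rule for a differentiable function along a curve that is an
    indefinite integral (Rintegral_chain_rule), applied to the components of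
    Psi in one direction and of Phi in the other, the Jacobians of Phi and Psi
    being inverse to each other.  The fields f and g are only assumed regular
    at the origin, so the velocity of a solution is merely integrable and the
    classical chain rule is not available.  The rule is obtained from a sup
    argument: the defect in the chain rule is, near every point of the time
    interval, at most e times the integral of a norm of the velocity, and
    such local bounds add up (increment_le).

    The coefficients of the inverse. The local inverse is smooth because its
    derivative is inv(J(Psi)), J the Jacobian of Phi; iterated derivatives of
    Psi therefore stay in the algebra generated by functions H o Psi, H
    smooth, and reciprocals of their nonvanishing elements
    (smooth_on_field_closure, inverse_smooth).  Substituting the series of
    Phi into the p-th tensor power gives the homogeneous parts
    tensor_sum p q z^q (kron_pow_expansion), because the tensor sums satisfy
    the same recursion on p as the coefficients of a p-fold product
    (tensor_partS).  The recursion defining P says precisely that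
    sum_j P_j tensor_sum j q z^q is z for q = 1 and 0 for q > 1
    (inverse_coefficients_tensor_part): the diagonal sum tensor_sum q q is the
    q-th tensor power of T_1, which the factor P_1^(tensor q) cancels.  Hence
    sum_(j < N) P_j Phi(z)^j = z + O(|z|^N); putting z = Psi(y) and
    comparing with the Taylor expansion of Psi (taylor_remainder), two
    polynomials in y with the same error O(|y|^N) must agree in every
    degree below N (homogeneous_parts_unique). *)

(** * Norms and differentials of column vectors *)

(** The normed and the complete structures of column vectors, joined so that
    the contraction principle applies to them. *)
HB.instance Definition _ (R : realType) (n : nat) :=
  Complete.copy 'cV[R]_n 'cV[R]_n.

Section MatrixNorm.
Variable R : realType.

Lemma norm_mx_le m n (A : 'M[R]_(m, n)) (e : R) :
  0 <= e -> (forall i j, `|A i j| <= e) -> `|A| <= e.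
Proof. by move=> e0 h; rewrite /Num.Def.normr /= mx_normrE bigmax_le. Qed.

Lemma coord_le_norm m n (A : 'M[R]_(m, n)) i j : `|A i j| <= `|A|.
Proof.
rewrite [leRHS]/Num.Def.normr /= mx_normrE.
exact: (le_bigmax _ (fun ij => `|A ij.1 ij.2|) (i, j)).
Qed.

Lemma mulmx_norm_le m n k (A : 'M[R]_(m, n)) (B : 'M[R]_(n, k)) :
  `|A *m B| <= n%:R * (`|A| * `|B|).
Proof.
apply: norm_mx_le => [|i j]; first by rewrite !mulr_ge0.
rewrite mxE (le_trans (ler_norm_sum _ _ _))//.
rewrite [leRHS](_ : _ = \sum_(l < n) (`|A| * `|B|)); last first.
  by rewrite sumr_const card_ord mulr_natl.
by apply: ler_sum => l _; rewrite normrM ler_pM// coord_le_norm.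
Qed.

Lemma mulmx_bound m n (A : 'M[R]_(m, n)) :
  exists2 C : R, 0 < C & forall v : 'cV[R]_n, `|A *m v| <= C * `|v|.
Proof.
exists (n%:R * `|A| + 1); first by rewrite ltr_wpDl// mulr_ge0.
move=> v; apply: le_trans (mulmx_norm_le _ _) _.
by rewrite mulrA ler_wpM2r// lerDl.
Qed.

Lemma mulmx_continuous m n (A : 'M[R]_(m, n)) :
  continuous (mulmx A : 'cV[R]_n -> 'cV[R]_m).
Proof.
have [C C0 AC] := mulmx_bound A.
apply: (@bounded_linear_continuous _ _ _ (mulmx A : {linear 'cV[R]_n -> 'cV[R]_m})).
apply/linear_boundedP; near=> r => v.
apply: le_trans (AC v) _; rewrite ler_wpM2r//.
Unshelve. all: by end_near. Qed.

End MatrixNorm.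

Section Differentials.
Variable R : realType.

(** Differentiability is used through this pair of epsilon estimates, which
    avoid the algebra of little-o terms. *)
Lemma differentiable_eps (V W : normedModType R) (F : V -> W) (x : V) :
  differentiable F x -> forall e : R, 0 < e ->
  \forall y \near x, `|F y - F x - 'd F x (y - x)| <= e * `|y - x|.
Proof.
move=> /diff_locally /eqaddoP dF e e0; have := dF e e0.
rewrite [X in _ -> X](near_shift 0) subr0; apply: filterS => h /=.
by rewrite !fctE /= opprD addrA addrK.
Qed.

Lemma eps_differentiable (V W : normedModType R) (F : V -> W) (x : V)
    (L : {linear V -> W}) : continuous L ->
  (forall e : R, 0 < e ->
     \forall y \near x, `|F y - F x - L (y - x)| <= e * `|y - x|) ->
  differentiable F x /\ 'd F x = L :> (V -> W).
Proof.
move=> cL FL.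
have E : F \o shift x = cst (F x) + L +o_ 0 id.
  apply/eqaddoP => e e0; have := FL e e0.
  rewrite [X in X -> _](near_shift 0) subr0; apply: filterS => h /=.
  by rewrite !fctE /= opprD addrA addrK.
have dFL := diff_unique cL E.
by split=> //; apply/diff_locallyP; rewrite dFL.
Qed.

Lemma differentiable_mxP (V : normedModType R) n (F : V -> 'cV[R]_n) (x : V) :
  differentiable F x <-> forall i, differentiable (fun y => F y i 0) x.
Proof.
split=> [dF i|dF].
  have -> : (fun y => F y i 0) = (fun M : 'cV[R]_n => M i 0) \o F by [].
  by apply: differentiable_comp => //; exact: differentiable_coord.
have -> : F = \sum_(i < n) (fun y => F y i 0 *: (delta_mx i 0 : 'cV[R]_n)).
  apply/funext => y; rewrite fct_sumE [LHS]matrix_sum_delta.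
  by apply: eq_bigr => i _; rewrite big_ord_recl big_ord0 addr0 (ord1 0).
by apply: differentiable_sum => i; exact: differentiableZl.
Qed.

Lemma derive_coord (V : normedModType R) n (F : V -> 'cV[R]_n) (x v : V) i :
  differentiable F x -> ('D_v F x) i 0 = 'D_v (fun y => F y i 0) x.
Proof. by move=> dF; rewrite derive_mx ?mxE//; exact: diff_derivable. Qed.

Lemma derive_partials n (W : normedModType R) (F : 'cV[R]_n -> W) x v :
  differentiable F x ->
  'D_v F x = \sum_(j < n) v j 0 *: 'D_(delta_mx j 0) F x.
Proof.
move=> dF; rewrite deriveE// {1}(matrix_sum_delta v) linear_sum.
apply: eq_bigr => j _; rewrite big_ord_recl big_ord0 addr0 (ord1 0).
by rewrite linearZ /= deriveE.
Qed.

Lemma derive_jacobian n p (F : 'cV[R]_n -> 'cV[R]_p) x v :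
  differentiable F x -> 'D_v F x = jacobian_mx F x *m v.
Proof.
move=> dF; rewrite derive_partials//; apply/matrixP => i j.
rewrite (ord1 j) summxE !mxE; apply: eq_bigr => l _.
by rewrite !mxE mulrC.
Qed.

End Differentials.

(** * Local inversion *)

Section LocalInversion.
Variable R : realType.

Lemma is_derive_line (V W : normedModType R) (F : V -> W) (x v : V) (t : R) :
  differentiable F (x + t *: v) ->
  is_derive t (1 : R) (fun s : R => F (x + s *: v)) ('D_v F (x + t *: v)).
Proof.
move=> /(@diff_derivable _ _ _ _ _ v) dF.
have E : (fun h : R => h^-1 *: (((fun s : R => F (x + s *: v)) \o shift t) (h *: (1 : R))
   - F (x + t *: v))) = (fun h : R => h^-1 *: ((F \o shift (x + t *: v)) (h *: v) - F (x + t *: v))).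
  apply/funext => h /=; congr (_ *: (F _ - _)).
  by rewrite /shift /= [h%:A]mulr1 scalerDl addrCA.
by split; [rewrite /derivable E|rewrite /derive E].
Qed.

Lemma ball_segment (V : normedModType R) (x y c : V) (r t : R) :
  `|x - c| < r -> `|y - c| < r -> 0 <= t <= 1 -> `|x + t *: (y - x) - c| < r.
Proof.
move=> xr yr /andP[t0 t1].
have -> : x + t *: (y - x) - c = (1 - t) *: (x - c) + t *: (y - c).
  rewrite scalerBl scale1r -[RHS]addrA [- _ + _]addrC -scalerBr opprB addrA subrK.
  by rewrite addrAC.
have [->|t_neq1] := eqVneq t 1; first by rewrite subrr scale0r add0r scale1r.
apply: le_lt_trans (ler_normD _ _) _; rewrite !normrZ.
rewrite (ger0_norm t0) ger0_norm ?subr_ge0//.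
have t1' : t < 1 by rewrite lt_neqAle t_neq1.
by nra.
Qed.

(** Continuity of the partial derivatives makes F strictly differentiable: the
    mean value theorem on the segment from w to z, one component at a time,
    reduces the estimate to the variation of the partial derivatives. *)
Lemma strict_differentiability n p (F : 'cV[R]_n -> 'cV[R]_p) (z0 : 'cV[R]_n) :
  (\forall z \near z0, differentiable F z) ->
  (forall j, {for z0, continuous ('D_(delta_mx j 0) F)}) ->
  forall e : R, 0 < e -> exists2 r : R, 0 < r &
    forall z w : 'cV[R]_n, `|z - z0| < r -> `|w - z0| < r ->
      `|F z - F w - jacobian_mx F z0 *m (z - w)| <= e * `|z - w|.
Proof.
move=> dF cF e e0.
pose d := e / n.+1%:R.
have d0 : 0 < d by rewrite divr_gt0.
have : \forall z \near z0, differentiable F z /\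
    forall j, `|'D_(delta_mx j 0) F z - 'D_(delta_mx j 0) F z0| <= d.
  apply: filterI => //.
  apply: (@filter_forall _ _ (fun j z => `|'D_(delta_mx j 0) F z - 'D_(delta_mx j 0) F z0| <= d)
    (nbhs z0) (nbhs_filter z0)) => j.
  exact: cvgr_distC_le (cF j) _ d0.
move=> /nbhs_ballP[r /= r0 rF]; exists r => // z w zr wr.
apply: norm_mx_le => [|i j]; first by rewrite mulr_ge0// ltW.
rewrite {j}(ord1 j).
pose v : 'cV[R]_n := z - w; pose a : R := (jacobian_mx F z0 *m v) i 0.
pose phi (t : R) : R := F (w + t *: v) i 0 - t * a.
have inb (t : R) : 0 <= t <= 1 -> ball z0 r (w + t *: v).
  move=> t01; rewrite -ball_normE /= distrC; exact: ball_segment.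
have dphi (t : R) : 0 <= t <= 1 ->
    is_derive t (1 : R) phi (('D_v F (w + t *: v)) i 0 - a).
  move=> t01; have [dFt _] := rF _ (inb t t01).
  apply: is_deriveB.
    rewrite derive_coord//; apply: (@is_derive_line 'cV[R]_n R (fun y => F y i 0)).
    by move/differentiable_mxP : dFt.
  have -> : (fun t : R => t * a) = a *: (@id R).
    by apply/funext => s; rewrite mulrC.
  by apply: is_derive_eq; rewrite [LHS]mulr1.
have [t t01||c c01] := @MVT R phi (fun t => ('D_v F (w + t *: v)) i 0 - a) 0 1 ltr01.
- by apply: dphi; move: t01; rewrite in_itv /= => /andP[/ltW -> /ltW ->].
- by apply: derivable_within_continuous => t t01; have [] := dphi t t01.
rewrite /phi subr0 mulr1 scale1r scale0r addr0 mul1r mul0r subr0 subrKC => E.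
have c01' : 0 <= c <= 1.
  by move: c01; rewrite in_itv /= => /andP[/ltW -> /ltW ->].
have [dFc Fc] := rF _ (inb c c01').
have -> : (F z - F w - jacobian_mx F z0 *m (z - w)) i 0 =
    \sum_(j < n) v j 0 * ('D_(delta_mx j 0) F (w + c *: v) - 'D_(delta_mx j 0) F z0) i 0.
  transitivity (('D_v F (w + c *: v)) i 0 - a).
    by rewrite -E !mxE /a mxE; lra.
  rewrite derive_partials// summxE /a mxE -sumrB; apply: eq_bigr => j _.
  by rewrite [jacobian_mx F z0 i j * _]mulrC !mxE -mulrBr.
apply: (@le_trans _ _ (\sum_(j < n) `|z - w| * d)).
  apply: le_trans (ler_norm_sum _ _ _) _; apply: ler_sum => j _.
  by rewrite normrM ler_pM// ?coord_le_norm// (le_trans (coord_le_norm _ _ _)).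
rewrite sumr_const card_ord -mulr_natl mulrA [leLHS]mulrC mulrA ler_wpM2r//.
by rewrite /d mulrAC ler_pdivrMr// ler_wpM2l ?ler_nat// ltW.
Qed.

(** By strict differentiability, A^-1 F differs from the identity by a map of
    Lipschitz constant 1/2 near z0, A the Jacobian at z0.  This gives the
    Lipschitz estimate for the inverse, and makes z |-> z - A^-1 (F z - y) a
    contraction of a closed ball when y is close to F z0; its fixed point is a
    preimage of y. *)
Lemma local_inversion n (F : 'cV[R]_n -> 'cV[R]_n) (z0 : 'cV[R]_n) :
  (\forall z \near z0, differentiable F z) ->
  (forall j, {for z0, continuous ('D_(delta_mx j 0) F)}) ->
  jacobian_mx F z0 \in unitmx ->
  exists r C : R, [/\ 0 < r, 0 < C,
    (forall z w : 'cV[R]_n, `|z - z0| < r -> `|w - z0| < r -> `|z - w| <= C * `|F z - F w|) &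
    (forall rho : R, 0 < rho < r -> forall y : 'cV[R]_n, `|y - F z0| <= rho / C ->
       exists2 z : 'cV[R]_n, `|z - z0| <= rho & F z = y)].
Proof.
move=> dF cF uA; set A := jacobian_mx F z0 in uA *.
have [C C0 AC] := mulmx_bound (invmx A).
(* C bounds invmx A, so an error 1/(2C) for F becomes 1/2 after invmx A. *)
have e0 : 0 < (2 * C)^-1 by rewrite invr_gt0 mulr_gt0.
have [r r0 rF] := strict_differentiability dF cF e0.
have contr z w : `|z - z0| < r -> `|w - z0| < r ->
    `|invmx A *m (F z - F w) - (z - w)| <= 2^-1 * `|z - w|.
  move=> zr wr.
  rewrite -{1}(mulKmx uA (z - w)) -mulmxBr (le_trans (AC _))//.
  have := rF z w zr wr.
  move=> /(ler_wpM2l (ltW C0)) /le_trans; apply.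
  by rewrite mulrA invfM [C * _]mulrC divfK// gt_eqF.
exists r, (2 * C); split=> //; first by rewrite mulr_gt0.
  move=> z w zr wr; have h1 := contr z w zr wr; have h2 := AC (F z - F w).
  have : `|z - w| <= `|invmx A *m (F z - F w)| + `|invmx A *m (F z - F w) - (z - w)|.
    by rewrite -[X in `|X| <= _](subKr (invmx A *m (F z - F w))) ler_normB.
  by move=> h3; rewrite -mulrA; lra.
move=> rho /andP[rho0 rhor] y yr.
pose U : set 'cV[R]_n := [set z | `|z - z0| <= rho].
pose g (z : 'cV[R]_n) : 'cV[R]_n := z - invmx A *m (F z - y).
have Ur z : U z -> `|z - z0| < r by move=> /le_lt_trans; apply.
have gB z w : U z -> U w -> `|g z - g w| <= 2^-1 * `|z - w|.
  move=> Uz Uw; rewrite -normrN; apply: le_trans (contr z w (Ur _ Uz) (Ur _ Uw)).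
  rewrite /g [X in `|X| <= _](_ : _ = invmx A *m (F z - F w) - (z - w))//.
  have -> : F z - F w = (F z - y) - (F w - y) by rewrite opprB addrA subrK.
  rewrite [invmx A *m (F z - y - _)]mulmxBr.
  by apply/matrixP => i j; rewrite !mxE; lra.
have gU z : U z -> U (g z).
  move=> Uz; rewrite /U /=.
  have -> : g z - z0 = (g z - g z0) + (g z0 - z0) by rewrite addrA subrK.
  have Uz0 : U z0 by rewrite /U /= subrr normr0 ltW.
  have h1 := gB _ _ Uz Uz0.
  have h2 : `|g z0 - z0| <= C * (rho / (2 * C)).
    rewrite /g addrAC subrr add0r normrN (le_trans (AC _))// ler_wpM2l ?(ltW C0)//.
    by rewrite distrC.
  have h3 : C * (rho / (2 * C)) = rho / 2 by field; rewrite gt_eqF.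
  apply: le_trans (ler_normD _ _) _; move: (Uz); rewrite /U /= => h4.
  by rewrite h3 in h2; lra.
pose gf : {fun U >-> U} := mkfun gU.
have cgf : is_contraction gf.
  exists (2^-1)%:nng; split => /=; first by rewrite invf_lt1// ltr1n.
  by move=> [z w] [/= Uz Uw]; exact: gB.
have clU : closed U.
  rewrite /U (_ : mkset _ = closed_ball z0 rho); first exact: closed_ball_closed.
  rewrite closed_ballE//.
  by apply/seteqP; split => z; rewrite /closed_ball_ /= distrC.
have [|p Up /= pE] := banach_fixed_point cgf clU.
  by exists z0; rewrite /U /= subrr normr0 ltW.
exists p => //; apply/eqP; rewrite -subr_eq0; apply/eqP.
rewrite -[LHS](mulKVmx uA).
suff -> : invmx A *m (F p - y) = 0 by rewrite mulmx0.
apply: oppr_inj; rewrite oppr0; apply: (addrI p); rewrite addr0.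
exact: esym pE.
Qed.

End LocalInversion.

(** * Closure properties of smooth functions *)

Section SmoothFunctions.
Variables (R : realType) (n : nat).
Local Notation V := 'cV[R]_n.

Lemma near_eq_differentiable (X W : normedModType R) (f g : X -> W) (x : X) :
  (\near x, f x = g x) -> differentiable g x -> differentiable f x.
Proof.
move=> fg dg.
have [|//] := @eps_differentiable R X W f x ('d g x) (diff_continuous dg) _.
move=> e e0; have gxe := differentiable_eps dg e0.
have fx := nbhs_singleton fg.
by move: fg gxe; apply: filterS2 => y -> ; rewrite fx.
Qed.

Lemma smooth_on_differentiable (W : normedModType R) (A : set V) (F : V -> W) x :
  smooth_on A F -> A x -> differentiable F x.
Proof. by move=> sF Ax; exact: (sF x Ax [::]). Qed.

Lemma smooth_on_derive (W : normedModType R) (A : set V) (F : V -> W) v :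
  smooth_on A F -> smooth_on A ('D_v F).
Proof.
move=> sF x Ax vs; have := sF x Ax (rcons vs v).
by rewrite /iter_derive foldr_rcons.
Qed.

(** Smoothness is a coinductive property: a class of differentiable functions
    that is stable under directional derivatives, up to equality on A, consists
    of smooth functions.  Stability up to equality is what makes this usable:
    derivative formulas only hold on A. *)
Lemma smooth_on_coinduction (W : normedModType R) (A : set V)
    (K : (V -> W) -> Prop) : open A ->
  (forall f, K f -> (forall x, A x -> differentiable f x) /\
     forall v, exists2 g, K g & forall x, A x -> 'D_v f x = g x) ->
  forall f, K f -> smooth_on A f.
Proof.
move=> oA KP f Kf.
have main vs : exists2 g, K g & forall x, A x -> iter_derive vs f x = g x.
  elim: vs => [|v vs [g Kg fg]]; first by exists f.
  have [_ /(_ v) [h Kh gh]] := KP g Kg; exists h => // x Ax.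
  rewrite -gh//=; apply: near_eq_derive.
  by apply: filterS (open_nbhs_nbhs (conj oA Ax)) => y Ay; exact: fg.
move=> x Ax vs; have [g Kg fg] := main vs.
apply: (@near_eq_differentiable _ _ _ g).
  by apply: filterS (open_nbhs_nbhs (conj oA Ax)) => y Ay; exact: fg.
by have [dg _] := KP g Kg; exact: dg.
Qed.

Lemma smooth_on_coord (A : set V) p (F : V -> 'cV[R]_p) i :
  open A -> smooth_on A F -> smooth_on A (fun x => F x i 0).
Proof.
move=> oA sF.
apply: (@smooth_on_coinduction R A (fun f => exists2 F : V -> 'cV[R]_p,
  smooth_on A F & f = (fun x => F x i 0))) => //; last by exists F.
move=> _ [{sF}F sF ->]; split=> [x Ax|v].
  exact: (differentiable_mxP _ _).1 (smooth_on_differentiable sF Ax) i.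
exists (fun x => 'D_v F x i 0).
  by exists ('D_v F) => //; exact: smooth_on_derive.
by move=> x Ax; rewrite derive_coord//; exact: smooth_on_differentiable sF Ax.
Qed.

Lemma smooth_on_id (A : set V) : open A -> smooth_on A (@id V).
Proof.
move=> oA.
apply: (@smooth_on_coinduction V A (fun f => f = id \/ exists c, f = cst c)) => //;
  last by left.
move=> _ [->|[c ->]]; split=> [x Ax|v].
- by [].
- by exists (cst v); [right; exists v|move=> x Ax; rewrite derive_id].
- exact: differentiable_cst.
- by exists (cst 0); [right; exists 0|move=> x Ax; rewrite derive_cst].
Qed.

(** The functions obtained from generators G by rational operations.  This
    class contains the entries of inverse matrices and is stable under
    derivatives as soon as the derivatives of the generators belong to it. *)
Inductive field_closure (A : set V) (G : (V -> R) -> Prop) : (V -> R) -> Prop :=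
| fc_gen f of G f : field_closure A G f
| fc_cst c : field_closure A G (cst c)
| fc_add f g of field_closure A G f & field_closure A G g :
    field_closure A G (f + g)
| fc_mul f g of field_closure A G f & field_closure A G g :
    field_closure A G (f * g)
| fc_inv f of (forall x, A x -> f x != 0) & field_closure A G f :
    field_closure A G (fun x => (f x)^-1).

Lemma fc_sum (A : set V) (G : (V -> R) -> Prop) (I : Type) (s : seq I) (P : pred I)
    (F : I -> V -> R) : (forall i, field_closure A G (F i)) ->
  field_closure A G (fun x => \sum_(i <- s | P i) F i x).
Proof.
move=> GF.
have -> : (fun x => \sum_(i <- s | P i) F i x) = \sum_(i <- s | P i) F i.
  by apply/funext => x; rewrite fct_sumE.
by elim/big_ind : _ => //; [exact: fc_cst|exact: fc_add].
Qed.

Lemma fc_prod (A : set V) (G : (V -> R) -> Prop) (I : Type) (s : seq I) (P : pred I)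
    (F : I -> V -> R) : (forall i, field_closure A G (F i)) ->
  field_closure A G (fun x => \prod_(i <- s | P i) F i x).
Proof.
move=> GF; elim: s => [|i s IHs].
  under eq_fun do rewrite big_nil; exact: fc_cst.
under eq_fun do rewrite big_cons; case: (P i) => //; exact: fc_mul.
Qed.

Lemma fc_det (A : set V) (G : (V -> R) -> Prop) m (M : V -> 'M[R]_m) :
  (forall i j, field_closure A G (fun x => M x i j)) ->
  field_closure A G (fun x => \det (M x)).
Proof.
move=> GM; apply: fc_sum => s; apply: fc_mul; first exact: fc_cst.
by apply: fc_prod => i; exact: GM.
Qed.

(** By Cramer's rule; the formula with the adjugate differs from invmx outside
    A, whence the auxiliary function f. *)
Lemma fc_inverse_entry (A : set V) (G : (V -> R) -> Prop) m (M : V -> 'M[R]_m) i j :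
  (forall x, A x -> M x \in unitmx) ->
  (forall i j, field_closure A G (fun x => M x i j)) ->
  exists2 f, field_closure A G f & forall x, A x -> invmx (M x) i j = f x.
Proof.
move=> uM GM; exists (fun x => (\det (M x))^-1 * cofactor (M x) j i).
  apply: fc_mul.
    apply: fc_inv; last exact: fc_det.
    by move=> x /uM; rewrite unitmxE unitfE.
  apply: fc_mul; first exact: fc_cst.
  apply: fc_det => k l; under eq_fun do rewrite !mxE; exact: GM.
by move=> x /uM uMx; rewrite /invmx uMx !mxE.
Qed.

Lemma field_closure_derive (A : set V) (G : (V -> R) -> Prop) :
  (forall f, G f -> (forall x, A x -> differentiable f x) /\
     forall v, exists2 g, field_closure A G g & forall x, A x -> 'D_v f x = g x) ->
  forall f, field_closure A G f -> (forall x, A x -> differentiable f x) /\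
     forall v, exists2 g, field_closure A G g & forall x, A x -> 'D_v f x = g x.
Proof.
move=> GP f; elim=> {f}.
- exact: GP.
- move=> c; split=> [x Ax|v]; first exact: differentiable_cst.
  by exists (cst 0); [exact: fc_cst|move=> x Ax; rewrite derive_cst].
- move=> f g Gf [df Df] Gg [dg Dg]; split=> [x Ax|v].
    by apply: differentiableD; [exact: df|exact: dg].
  have [f' Gf' ff'] := Df v; have [g' Gg' gg'] := Dg v.
  exists (f' + g'); first exact: fc_add.
  move=> x Ax; rewrite deriveD; [|exact: diff_derivable (df _ Ax)|exact: diff_derivable (dg _ Ax)].
  by rewrite ff'// gg'.
- move=> f g Gf [df Df] Gg [dg Dg]; split=> [x Ax|v].
    by apply: differentiableM; [exact: df|exact: dg].
  have [f' Gf' ff'] := Df v; have [g' Gg' gg'] := Dg v.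
  exists (f * g' + g * f'); first by apply: fc_add; exact: fc_mul.
  move=> x Ax; rewrite deriveM; [|exact: diff_derivable (df _ Ax)|exact: diff_derivable (dg _ Ax)].
  by rewrite ff'// gg'.
- move=> f f0 Gf [df Df]; split=> [x Ax|v].
    by apply: differentiableV; [exact: df|exact: f0].
  have [f' Gf' ff'] := Df v.
  exists (cst (-1) * ((fun x => (f x)^-1) * (fun x => (f x)^-1)) * f').
    apply: fc_mul => //; apply: fc_mul; first exact: fc_cst.
    by apply: fc_mul; exact: fc_inv.
  move=> x Ax; rewrite deriveV; [|exact: f0|exact: diff_derivable (df _ Ax)].
  by rewrite ff'// !fctE /= mulN1r -expr2 exprVn.
Qed.

Lemma smooth_on_field_closure (A : set V) (G : (V -> R) -> Prop) p (F : V -> 'cV[R]_p) :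
  open A ->
  (forall f, G f -> (forall x, A x -> differentiable f x) /\
     forall v, exists2 g, field_closure A G g & forall x, A x -> 'D_v f x = g x) ->
  (forall i, field_closure A G (fun x => F x i 0)) -> smooth_on A F.
Proof.
move=> oA GP GF.
apply: (@smooth_on_coinduction _ A
  (fun F : V -> 'cV[R]_p => forall i, field_closure A G (fun x => F x i 0))) => // {GF}F GF.
have dF x : A x -> differentiable F x.
  move=> Ax; apply/differentiable_mxP => i.
  by have [dFi _] := field_closure_derive GP (GF i); exact: dFi.
split=> // v.
have /choice[g gP] : forall i, exists g, field_closure A G g /\
    forall x, A x -> 'D_v (fun x => F x i 0) x = g x.
  by move=> i; have [_ /(_ v)[g Gg gE]] := field_closure_derive GP (GF i); exists g.
exists (fun x => \col_i g i x).
  by move=> i; under eq_fun do rewrite mxE; have [] := gP i.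
move=> x Ax; apply/matrixP => i j; rewrite (ord1 j) mxE derive_coord//; last exact: dF.
by have [_ ->] := gP i.
Qed.

End SmoothFunctions.

(** * The local inverse and its smoothness *)

Section InverseFunction.
Variables (R : realType) (n : nat).
Local Notation V := 'cV[R]_n.

Lemma smooth_local_inversion (A : set V) (F : V -> V) (z0 : V) :
  open A -> smooth_on A F -> A z0 -> jacobian_mx F z0 \in unitmx ->
  exists r C : R, [/\ 0 < r, 0 < C,
    (forall z w : V, `|z - z0| < r -> `|w - z0| < r -> `|z - w| <= C * `|F z - F w|) &
    (forall rho : R, 0 < rho < r -> forall y : V, `|y - F z0| <= rho / C ->
       exists2 z : V, `|z - z0| <= rho & F z = y)].
Proof.
move=> oA sF Az0; apply: local_inversion => [|j].
  apply: filterS (open_nbhs_nbhs (conj oA Az0)) => z Az.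
  exact: smooth_on_differentiable sF Az.
exact: differentiable_continuous (sF z0 Az0 [:: delta_mx j 0]).
Qed.

Lemma open_norm (A : set V) z0 : open A -> A z0 ->
  exists2 r : R, 0 < r & forall z : V, `|z - z0| < r -> A z.
Proof.
move=> oA Az0; have /nbhs_ballP[r /= r0 rA] := open_nbhs_nbhs (conj oA Az0).
by exists r => // z zr; apply: rA; rewrite -ball_normE /= distrC.
Qed.

(** Surjectivity onto small balls in local_inversion, at every point of A. *)
Lemma smooth_open_map (A : set V) (F : V -> V) :
  open A -> smooth_on A F -> (forall z, A z -> jacobian_mx F z \in unitmx) ->
  open (F @` A).
Proof.
move=> oA sF uF; rewrite openE => _ [z0 Az0 <-].
have [r [C [r0 C0 _ onto]]] := smooth_local_inversion oA sF Az0 (uF _ Az0).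
have [s s0 sA] := open_norm oA Az0.
pose rho := Num.min r s / 2.
have rs0 : 0 < Num.min r s by rewrite lt_min r0.
have rho0 : 0 < rho by rewrite divr_gt0.
have rho_lt : rho < Num.min r s by rewrite ltr_pdivrMr// ltr_pMr// ltr1n.
move: (rho_lt); rewrite lt_min => /andP[rhor rhos].
apply/nbhs_ballP; exists (rho / C) => /=; first by rewrite divr_gt0.
move=> y; rewrite -ball_normE /= distrC => /ltW yr.
have [|z zrho zy] := onto rho _ y yr; first by rewrite rho0.
by exists z => //; apply: sA; exact: le_lt_trans rhos.
Qed.

Lemma local_inverse_exists (F : V -> V) :
  smooth_near0 F -> F 0 = 0 ->
  (\forall z \near (0 : V), jacobian_mx F z \in unitmx) ->
  exists G A B, local_inverse F G A B.
Proof.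
move=> sF F0 uF.
have : \forall z \near (0 : V), (forall vs, differentiable (iter_derive vs F) z)
    /\ jacobian_mx F z \in unitmx by exact: filterI.
move=> /nbhs_ballP[s /= s0 sW].
have ballopen (e : R) : open [set z : V | `|z| < e].
  rewrite (_ : mkset _ = ball (0 : V) e); first exact: ball_open.
  by apply/seteqP; split => z; rewrite -ball_normE /= sub0r normrN.
have inW (z : V) : `|z| < s -> (forall vs, differentiable (iter_derive vs F) z)
    /\ jacobian_mx F z \in unitmx.
  by move=> zs; apply: sW; rewrite -ball_normE /= sub0r normrN.
have sFs : smooth_on [set z : V | `|z| < s] F by move=> z zs; have [] := inW z zs.
have zero_s : `|0 : V| < s by rewrite normr0.
have [r [C [r0 C0 inj _]]] :=
  smooth_local_inversion (ballopen s) sFs zero_s (inW _ zero_s).2.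
pose A : set V := [set z | `|z| < Num.min r s].
have AP z : A z -> `|z| < r /\ `|z| < s by rewrite /A /= lt_min => /andP.
have oA : open A by exact: ballopen.
have A0 : A 0 by rewrite /A /= normr0 lt_min r0.
have sFA : smooth_on A F by move=> z /AP[_ zs]; exact: sFs.
have uA z : A z -> jacobian_mx F z \in unitmx by move=> /AP[_ zs]; have [] := inW z zs.
pose G y := xget 0 [set z | A z /\ F z = y].
have GP y : (F @` A) y -> A (G y) /\ F (G y) = y.
  by move=> [z Az zy]; apply: (@xgetPex _ 0 [set z | A z /\ F z = y]); exists z.
exists G, A, (F @` A); split=> //.
- by split; [exact: smooth_open_map|exists 0].
- move=> z Az; split; first by exists z.
  have [|AGz FGz] := GP (F z); first by exists z.
  apply/eqP; rewrite -subr_eq0 -normr_le0.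
  have := inj (G (F z)) z; rewrite !subr0 FGz subrr normr0 mulr0; apply.
    by have [] := AP _ AGz.
  by have [] := AP _ Az.
Qed.

Variables (Phi Psi : V -> V) (U W : set V).
Hypothesis inv : local_inverse Phi Psi U W.

(** The inverse Psi is given only as a function: its continuity follows from
    local surjectivity of Phi, which forces Psi y to be the preimage of y that
    local_inversion finds near Psi y0. *)
Lemma inverse_lipschitz y0 : W y0 ->
  exists2 C : R, 0 < C & \forall y \near y0, `|Psi y - Psi y0| <= C * `|y - y0|.
Proof.
move: inv => [[oU U0] [oW W0] [sPhi uPhi] UP WP] Wy0.
have [Uz0 Phiz0] := WP _ Wy0; set z0 := Psi y0 in Uz0 Phiz0 *.
have [r [C [r0 C0 inj onto]]] := smooth_local_inversion oU sPhi Uz0 (uPhi _ Uz0).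
have [s s0 sU] := open_norm oU Uz0.
exists C => //.
pose rho := Num.min r s / 2.
have rs0 : 0 < Num.min r s by rewrite lt_min r0.
have rho0 : 0 < rho by rewrite divr_gt0.
have rho_lt : rho < Num.min r s by rewrite ltr_pdivrMr// ltr_pMr// ltr1n.
move: (rho_lt); rewrite lt_min => /andP[rhor rhos].
apply/nbhs_ballP; exists (rho / C) => /=; first by rewrite divr_gt0.
move=> y; rewrite -ball_normE /= distrC => /ltW yr; rewrite -Phiz0 in yr.
have [|z zrho zy] := onto rho _ y yr; first by rewrite rho0.
have Uz : U z by apply: sU; exact: le_lt_trans rhos.
have -> : Psi y = z by rewrite -zy; have [] := UP _ Uz.
have := inj z z0 (le_lt_trans zrho rhor); rewrite subrr normr0 zy Phiz0; exact.
Qed.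

Lemma inverse_continuous y0 : W y0 -> {for y0, continuous Psi}.
Proof.
move=> /inverse_lipschitz[C C0 CP].
move=> P /= /nbhs_ballP[e /= e0 eP].
have ye : \forall y \near y0, `|y - y0| < e / C.
  apply/nbhs_ballP; exists (e / C) => /=; first by rewrite divr_gt0.
  by move=> y; rewrite -ball_normE /= distrC.
move: CP ye; apply: filterS2 => y h1 h2; apply: eP.
rewrite -ball_normE /= distrC (le_lt_trans h1)//.
by rewrite -ltr_pdivlMl// mulrC.
Qed.

(** The remainder of Psi at y0 is - J^-1 applied to the remainder of Phi at
    Psi y0, and is o(|y - y0|) by the Lipschitz estimate. *)
Lemma inverse_diff y0 : W y0 -> differentiable Psi y0 /\
  'd Psi y0 = mulmx (invmx (jacobian_mx Phi (Psi y0))) :> (V -> V).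
Proof.
move=> Wy0; move: inv => [[oU U0] [oW W0] [sPhi uPhi] UP WP].
have [Uz0 Phiz0] := WP _ Wy0; set z0 := Psi y0 in Uz0 Phiz0 *.
set J := jacobian_mx Phi z0.
have uJ : J \in unitmx by exact: uPhi.
apply: (@eps_differentiable R V V Psi y0 (mulmx (invmx J) : {linear V -> V})).
  exact: mulmx_continuous.
move=> e e0.
have [C C0 CP] := inverse_lipschitz Wy0.
have [D D0 DP] := mulmx_bound (invmx J).
have dPhi := smooth_on_differentiable sPhi Uz0.
have e1 : 0 < e / (D * C) by rewrite divr_gt0// mulr_gt0.
have := inverse_continuous Wy0 (differentiable_eps dPhi e1).
have := open_nbhs_nbhs (conj oW Wy0).
move: CP; apply: filterS3 => y h1 Wy /= h2.
have [_ Phiy] := WP _ Wy.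
rewrite Phiy Phiz0 in h2.
have -> : Psi y - Psi y0 - invmx J *m (y - y0) =
    - (invmx J *m (y - y0 - 'd Phi z0 (Psi y - z0))).
  rewrite -deriveE// derive_jacobian// [in RHS]mulmxBr mulmxA mulVmx// mul1mx.
  by rewrite opprB.
rewrite normrN (le_trans (DP _))//.
have h3 := ler_wpM2l (ltW D0) h2; apply: le_trans h3 _.
rewrite mulrA.
have -> : D * (e / (D * C)) = e / C by field; rewrite !gt_eqF.
by rewrite -mulrA ler_wpM2l ?(ltW e0)// ler_pdivrMl.
Qed.

Lemma inverse_derive y v : W y ->
  'D_v Psi y = invmx (jacobian_mx Phi (Psi y)) *m v.
Proof. by move=> /inverse_diff[dPsi dE]; rewrite deriveE// dE. Qed.

(** The derivative of H o Psi is sum_i (w_i) (D_i H o Psi) with w = J(Psi)^-1 v,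
    and the entries of J(Psi)^-1 are rational in functions K o Psi, K smooth.
    So the rational closure of all H o Psi is stable under derivatives, and it
    contains the components of Psi. *)
Lemma inverse_smooth : smooth_on W Psi.
Proof.
move: (inv) => [[oU U0] [oW W0] [sPhi uPhi] UP WP].
pose G f := exists2 H : V -> R, smooth_on U H & f = H \o Psi.
have GJ i j : field_closure W G (fun y => jacobian_mx Phi (Psi y) i j).
  apply: fc_gen; exists (fun z => 'D_(delta_mx j 0) Phi z i 0).
    by apply: smooth_on_coord => //; exact: smooth_on_derive.
  by apply/funext => y; rewrite mxE.
apply: (@smooth_on_field_closure R n W G n Psi oW); last first.
  move=> i; apply: fc_gen; exists (fun z => z i 0) => //.
  exact: (@smooth_on_coord R n U n id) (smooth_on_id oU).
move=> _ [H sH ->]; split=> [y Wy|v].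
  apply: differentiable_comp; first by have [] := inverse_diff Wy.
  by apply: (smooth_on_differentiable sH); have [] := WP _ Wy.
have /choice[w wP] : forall i, exists w, field_closure W G w /\
    forall y, W y -> (invmx (jacobian_mx Phi (Psi y)) *m v) i 0 = w y.
  move=> i.
  have /choice[q qP] : forall k, exists q, field_closure W G q /\
      forall y, W y -> invmx (jacobian_mx Phi (Psi y)) i k = q y.
    move=> k; have [|q Gq qE] := @fc_inverse_entry R n W G n
      (fun y => jacobian_mx Phi (Psi y)) i k _ GJ; last by exists q.
    by move=> y Wy; apply: uPhi; have [] := WP _ Wy.
  exists (fun y => \sum_k q k y * v k 0); split.
    by apply: fc_sum => k; apply: fc_mul; [have [] := qP k|exact: fc_cst].
  by move=> y Wy; rewrite mxE; apply: eq_bigr => k _; have [_ ->] := qP k.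
exists (fun y => \sum_i w i y * 'D_(delta_mx i 0) H (Psi y)).
  apply: fc_sum => i; apply: fc_mul; first by have [] := wP i.
  apply: fc_gen; exists ('D_(delta_mx i 0) H) => //; exact: smooth_on_derive.
move=> y Wy; have [Uz _] := WP _ Wy; have [dPsi dE] := inverse_diff Wy.
have dH : differentiable H (Psi y) := smooth_on_differentiable sH Uz.
rewrite deriveE; last exact: differentiable_comp.
rewrite diff_comp//= dE -deriveE// derive_partials//.
by apply: eq_bigr => i _; have [_ ->] := wP i.
Qed.

End InverseFunction.

(** * Taylor expansion *)

Section Taylor.
Variable R : realType.

Lemma is_derive_taylor_term (c : R) k (t : R) :
  is_derive t (1 : R) (fun s : R => c * s ^+ k.+1 / (k.+1)`!%:R) (c * t ^+ k / k`!%:R).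
Proof.
have -> : (fun s : R => c * s ^+ k.+1 / (k.+1)`!%:R) =
    (c / (k.+1)`!%:R) *: (fun s : R => s ^+ k.+1).
  by apply/funext => s; rewrite /= mulrAC.
have dX : is_derive t (1 : R) (fun s : R => s ^+ k.+1) (k.+1%:R *: t ^+ k *: (1 : R)).
  by split; [exact: exprn_derivable|exact: exp_derive].
apply: is_derive_eq.
rewrite /GRing.scale /= mulr1 factS natrM.
have k0 : k`!%:R != 0 :> R by rewrite pnatr_eq0 -lt0n fact_gt0.
by field; rewrite k0 nat1r pnatr_eq0.
Qed.

(** The sequence h stands for the successive derivatives of h 0.  The constant
    is not divided by N!: the crude bound suffices for order comparisons and
    makes the induction a single use of the mean value theorem. *)
Lemma taylor_remainder_1d (N : nat) (h : nat -> R -> R) (C : R) :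
  (forall k (t : R), (k < N)%N -> 0 <= t <= 1 -> is_derive t (1 : R) (h k) (h k.+1 t)) ->
  (forall t : R, 0 <= t <= 1 -> `|h N t| <= C) ->
  forall t : R, 0 <= t <= 1 ->
    `|h 0%N t - \sum_(k < N) h k 0 * t ^+ k / k`!%:R| <= C * t ^+ N.
Proof.
elim: N h => [|N IHN] h dh hC t t01.
  by rewrite big_ord0 subr0 expr0 mulr1; exact: hC.
have IH : forall s : R, 0 <= s <= 1 ->
    `|h 1%N s - \sum_(k < N) h k.+1 0 * s ^+ k / k`!%:R| <= C * s ^+ N.
  apply: (IHN (fun k => h k.+1)) => // k s kN s01; exact: dh.
pose r (s : R) : R := h 0%N s - \sum_(k < N.+1) h k 0 * s ^+ k / k`!%:R.
have dr (s : R) : 0 <= s <= 1 -> is_derive s (1 : R) r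
    (h 1%N s - \sum_(k < N) h k.+1 0 * s ^+ k / k`!%:R).
  move=> s01; apply: is_deriveB; first exact: dh.
  have -> : (fun s : R => \sum_(k < N.+1) h k 0 * s ^+ k / k`!%:R) =
      cst (h 0%N 0) + \sum_(k < N) (fun s : R => h k.+1 0 * s ^+ k.+1 / (k.+1)`!%:R).
    apply/funext => u; rewrite big_ord_recl expr0 fact0 divr1 mulr1 !fctE.
    by rewrite fct_sumE.
  rewrite -[X in is_derive _ _ _ X]add0r; apply: is_deriveD.
  by apply: is_derive_sum => k; exact: is_derive_taylor_term.
have r0 : r 0 = 0.
  rewrite /r big_ord_recl expr0 fact0 divr1 mulr1 big1 ?addr0 ?subrr// => k _.
  by rewrite expr0n mulr0 mul0r.
move: (t01) => /andP[t0 t1].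
have [||c c0t] := @MVT_segment R r
  (fun s => h 1%N s - \sum_(k < N) h k.+1 0 * s ^+ k / k`!%:R) 0 t t0.
- move=> x; rewrite in_itv /= => /andP[x0 xt]; apply: dr.
  by rewrite (ltW x0) (ltW (lt_le_trans xt t1)).
- apply: derivable_within_continuous => s; rewrite in_itv /= => /andP[s0 st].
  by have [|] := dr s; rewrite ?s0//= (le_trans st).
rewrite r0 !subr0 -/(r t) => ->.
move: c0t; rewrite in_itv /= => /andP[c0 ct].
have c01 : 0 <= c <= 1 by rewrite c0 (le_trans ct).
rewrite normrM (ger0_norm t0) exprSr mulrA ler_wpM2r// (le_trans (IH _ c01))//.
have C0 : 0 <= C by apply: le_trans (hC 0 _); rewrite ?lexx ?ler01.
by rewrite ler_wpM2l// lerXn2r.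
Qed.

End Taylor.

Section MultivariateTaylor.
Variables (R : realType) (n : nat).
Local Notation V := 'cV[R]_n.

Lemma iter_derive_lincomb (W : normedModType R) (A : set V) (F : V -> W) m
    (c : 'I_m -> R) (G : 'I_m -> V -> W) :
  open A -> (forall i, smooth_on A (G i)) ->
  (forall y, A y -> F y = \sum_(i < m) c i *: G i y) ->
  forall vs y, A y ->
    iter_derive vs F y = \sum_(i < m) c i *: iter_derive vs (G i) y.
Proof.
move=> oA sG FG; elim=> [|v vs IHvs] y Ay /=; first exact: FG.
have dG i : derivable (iter_derive vs (G i)) y v.
  by apply: diff_derivable; exact: sG.
transitivity ('D_v (\sum_(i < m) (c i *: iter_derive vs (G i))) y).
  apply: near_eq_derive.
  apply: filterS (open_nbhs_nbhs (conj oA Ay)) => z Az.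
  by rewrite IHvs// fct_sumE.
rewrite derive_sum => [|i]; last exact: derivableZ.
by apply: eq_bigr => i _; rewrite deriveZ.
Qed.

Lemma iter_derive_nseqS (W : normedModType R) k (x : V) (F : V -> W) :
  iter_derive (nseq k.+1 x) F = iter_derive (nseq k x) ('D_x F).
Proof.
by rewrite -[k.+1]addn1 nseqD cats1 /iter_derive foldr_rcons.
Qed.

(** The constant must not depend on the direction x.  Expanding the innermost
    derivative in coordinates reduces k derivatives of F in direction x to k - 1
    derivatives of the n partial derivatives of F. *)
Lemma iter_derive_bound (W : normedModType R) (A : set V) (F : V -> W) k (z : V) :
  open A -> A z -> smooth_on A F ->
  exists2 C : R, 0 <= C &
    \forall y \near z, forall x, `|iter_derive (nseq k x) F y| <= C * `|x| ^+ k.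
Proof.
move=> oA Az; elim: k F => [|k IHk] F sF.
  exists (`|F z| + 1); first by rewrite addr_ge0.
  have cF : {for z, continuous F}.
    by apply: differentiable_continuous; exact: smooth_on_differentiable sF Az.
  have : \forall y \near z, ball (F z) 1 (F y).
    by apply: cF; exact: nbhsx_ballx.
  apply: filterS => y /=; rewrite -ball_normE /= distrC => /ltW Fy x.
  rewrite /= expr0 mulr1 -[F y](subrK (F z)) addrC.
  by rewrite (le_trans (ler_normD _ _))// lerD2l.
have /choice[C CP] : forall i : 'I_n, exists C : R, 0 <= C /\
    \forall y \near z, forall x,
      `|iter_derive (nseq k x) ('D_(delta_mx i 0) F) y| <= C * `|x| ^+ k.
  by move=> i; have [C C0 CP] := IHk _ (smooth_on_derive (delta_mx i 0) sF); exists C.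
exists (\sum_i C i); first by apply: sumr_ge0 => i _; have [] := CP i.
have : \forall y \near z, A y /\ forall i x,
      `|iter_derive (nseq k x) ('D_(delta_mx i 0) F) y| <= C i * `|x| ^+ k.
  apply: filterI; first exact: (open_nbhs_nbhs (conj oA Az)).
  apply: (@filter_forall _ _ (fun i y => forall x,
      `|iter_derive (nseq k x) ('D_(delta_mx i 0) F) y| <= C i * `|x| ^+ k)
    (nbhs z) (nbhs_filter z)) => i.
  by have [] := CP i.
apply: filterS => y [Ay yC] x.
rewrite iter_derive_nseqS.
rewrite (@iter_derive_lincomb W A ('D_x F) n (fun i => x i 0)
  (fun i => 'D_(delta_mx i 0) F) oA _ _ _ y Ay); last 2 first.
- by move=> i; exact: smooth_on_derive.
- by move=> u Au; rewrite derive_partials//; exact: smooth_on_differentiable sF Au.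
rewrite (le_trans (ler_norm_sum _ _ _))// mulr_suml; apply: ler_sum => i _.
by rewrite normrZ exprS mulrCA ler_pM ?coord_le_norm.
Qed.

(** One-dimensional Taylor expansion along the segment from 0 to x, for each
    component; iter_derive_bound makes the remainder uniform in x. *)
Lemma taylor_remainder p (A : set V) (F : V -> 'cV[R]_p) (N : nat) :
  open A -> A 0 -> smooth_on A F ->
  exists2 C : R, 0 <= C & \forall x \near (0 : V),
    `|F x - \sum_(k < N) taylor_part k F x| <= C * `|x| ^+ N.
Proof.
move=> oA A0 sF; have [C C0 CP] := iter_derive_bound N oA A0 sF.
exists C => //.
have /nbhs_ballP[r /= r0 rP] : \forall y \near (0 : V), A y /\
    forall x, `|iter_derive (nseq N x) F y| <= C * `|x| ^+ N.
  by apply: filterI => //; exact: (open_nbhs_nbhs (conj oA A0)).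
apply/nbhs_ballP; exists r => //= x.
rewrite -ball_normE /= sub0r normrN => xr.
have inb (t : R) : 0 <= t <= 1 -> A (0 + t *: x) /\
    forall u, `|iter_derive (nseq N u) F (0 + t *: x)| <= C * `|u| ^+ N.
  move=> /andP[t0 t1]; apply: rP; rewrite -ball_normE /= sub0r normrN add0r.
  by rewrite normrZ ger0_norm// (le_lt_trans _ xr)// ler_piMl.
apply: norm_mx_le => [|i j]; first by rewrite mulr_ge0// exprn_ge0.
rewrite {j}(ord1 j).
have := @taylor_remainder_1d R N
  (fun k t => iter_derive (nseq k x) F (0 + t *: x) i 0) (C * `|x| ^+ N) _ _ 1.
rewrite expr1n mulr1 scale1r !add0r => /(_ _ _ _).
rewrite !mxE summxE.
under [in X in _ -> X]eq_bigr do rewrite mxE mulrC.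
under [in X in X -> _]eq_bigr do rewrite scale0r expr1n mulr1.
apply.
- move=> k t kN t01; have [At _] := inb t t01.
  have dF : differentiable (iter_derive (nseq k x) F) (0 + t *: x) by exact: sF.
  rewrite /= derive_coord//.
  apply: (@is_derive_line R V R (fun y => iter_derive (nseq k x) F y i 0)).
  by move/differentiable_mxP : dF.
- move=> t t01; have [_ Ct] := inb t t01.
  by rewrite (le_trans (coord_le_norm _ _ _)).
- by rewrite ler01 lexx.
Qed.

End MultivariateTaylor.

(** * The chain rule along indefinite integrals *)

Section IntegralChainRule.
Variable R : realType.
Local Notation mu := (@lebesgue_measure R).

(** The set of t for which the bound holds on [a, t] contains a; its supremum
    belongs to it by the local bound to the left, and is b by the local bound
    to the right. *)
Lemma increment_le (D G : R -> R) (a b : R) : a <= b ->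
  (forall c, a <= c <= b -> exists2 d : R, 0 < d &
     forall s t, a <= s -> s <= t -> t <= b -> s = c \/ t = c -> t - s < d ->
       `|D t - D s| <= G t - G s) ->
  `|D b - D a| <= G b - G a.
Proof.
move=> ab loc.
pose S : set R := [set t | a <= t <= b /\ `|D t - D a| <= G t - G a].
have Sa : S a by rewrite /S /= lexx ab !subrr normr0.
have hS : has_sup S by split; [exists a|exists b => t [/andP[]]].
pose c := sup S.
have ac : a <= c by exact: sup_upper_bound Sa.
have cb : c <= b by apply: ge_sup => [|t [/andP[]]//]; exists a.
have [|d d0 locc] := loc c; first by rewrite ac.
have step s t : S s -> s <= t -> t <= b -> s = c \/ t = c -> t - s < d -> S t.
  move=> [/andP[as_ sb] Ds] st tb sct std; split; first by rewrite tb (le_trans as_).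
  have := locc s t as_ st tb sct std.
  have : `|D t - D a| <= `|D t - D s| + `|D s - D a|.
    by rewrite (le_trans _ (ler_normD _ _))// addrA subrK.
  by lra.
have Sc : S c.
  have [s Ss cs] := sup_adherent d0 hS.
  apply: (step s) => //; [exact: sup_upper_bound|by right|].
  by move: cs; rewrite -/c; lra.
have [bc|cb'] := leP b c.
  by have <- : c = b; [lra|case: Sc].
exfalso.
pose t := Num.min b (c + d / 2).
have ct : c < t by rewrite lt_min cb' ltrDl divr_gt0.
have tb : t <= b by rewrite ge_min lexx.
have tc : t <= c + d / 2 by rewrite ge_min lexx orbT.
have St : S t by apply: (step c) => //; [exact: ltW|left|lra].
have : t <= c by exact: sup_upper_bound St.
by rewrite leNgt ct.
Qed.

Lemma within_segment_near (f : R -> R) (a b c e : R) :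
  {within `[a, b], continuous f} -> a <= c <= b -> 0 < e ->
  \forall t \near c, a <= t <= b -> `|f t - f c| <= e.
Proof.
move=> cf acb e0.
have := (subspace_continuousP _ _).1 cf c.
rewrite /= in_itv /= => /(_ acb) /cvgrPdist_le /(_ e e0).
rewrite near_withinE; apply: filterS => t /= tP atb; rewrite distrC; apply: tP.
by rewrite in_itv.
Qed.

Lemma integrable_sub (f : R -> R) (a b s t : R) : a <= s -> t <= b ->
  mu.-integrable `[a, b] (EFin \o f) -> mu.-integrable `[s, t] (EFin \o f).
Proof.
move=> as_ tb; apply: integrableS => //.
by apply: subset_itv; rewrite bnd_simp.
Qed.

Lemma Rintegral_split (f : R -> R) (a s t : R) : a <= s -> s <= t ->
  mu.-integrable `[a, t] (EFin \o f) ->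
  \int[mu]_(x in `[a, t]) f x - \int[mu]_(x in `[a, s]) f x =
  \int[mu]_(x in `[s, t]) f x.
Proof.
move=> as_ st fi; rewrite Rintegral_itvB ?bnd_simp//.
rewrite Rintegral_itv_obnd_cbnd//.
apply: integrableS fi => //.
by apply: subset_itv; rewrite bnd_simp.
Qed.

Lemma primitive_continuous (f r : R -> R) (a b : R) : a <= b ->
  mu.-integrable `[a, b] (EFin \o r) ->
  (forall t, a <= t <= b -> f t - f a = \int[mu]_(x in `[a, t]) r x) ->
  {within `[a, b], continuous f}.
Proof.
move=> ab ri fr.
have cI := parameterized_integral_continuous ab ri.
have cfa : {within `[a, b], continuous (fun t : R => f a)}.
  by apply: continuous_subspaceT => t; exact: cvg_cst.
have cS : {within `[a, b],
    continuous (fun t => f a + parameterized_integral mu a t r)}.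
  move=> t; exact: continuousD (cfa t) (cI t).
apply: (@subspace_eq_continuous _ _ _
  (fun t => f a + parameterized_integral mu a t r)) cS => u /set_mem.
rewrite /= in_itv /= => aub.
by rewrite /from_subspace /parameterized_integral -fr// addrC subrK.
Qed.

Lemma integrable_continuousM (r g : R -> R) (a b : R) :
  mu.-integrable `[a, b] (EFin \o r) -> {within `[a, b], continuous g} ->
  mu.-integrable `[a, b] (EFin \o (fun t => g t * r t)).
Proof.
move=> ri cg.
have -> : EFin \o (fun t => g t * r t) = ((EFin \o r) \* (EFin \o g))%E.
  by apply/funext => t /=; rewrite -EFinM mulrC.
apply: integrableMl => //.
  by apply: measurable_realfun.subspace_continuous_measurable_fun.
have := compact_bounded (continuous_compact cg (@segment_compact R a b)).
by move=> [M [Mr MP]]; exists M; split=> // N MN t tab; apply: MP => //; exists t.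
Qed.

Lemma integrable_EFinD (f g : R -> R) (A : set (measurableTypeR R)) : measurable A ->
  mu.-integrable A (EFin \o f) -> mu.-integrable A (EFin \o g) ->
  mu.-integrable A (EFin \o (fun x => f x + g x)).
Proof.
move=> mA fi gi; have := integrableD mA fi gi.
by congr (is_true (_ _ _)); apply/funext => x /=; rewrite EFinD.
Qed.

Lemma integrable_EFinZ (k : R) (f : R -> R) (A : set (measurableTypeR R)) : measurable A ->
  mu.-integrable A (EFin \o f) -> mu.-integrable A (EFin \o (fun x => k * f x)).
Proof.
move=> mA fi; have := integrableZl mA k fi.
by congr (is_true (_ _ _)); apply/funext => x /=; rewrite EFinM.
Qed.

Lemma integrable_EFinB (f g : R -> R) (A : set (measurableTypeR R)) : measurable A ->
  mu.-integrable A (EFin \o f) -> mu.-integrable A (EFin \o g) ->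
  mu.-integrable A (EFin \o (fun x => f x - g x)).
Proof.
move=> mA fi gi; have := integrableB mA fi gi.
by congr (is_true (_ _ _)); apply/funext => x /=; rewrite EFinB.
Qed.

Lemma Rintegral_sum (I : Type) (s : seq I) (f : I -> R -> R)
    (A : set (measurableTypeR R)) :
  measurable A -> (forall i, mu.-integrable A (EFin \o f i)) ->
  mu.-integrable A (EFin \o (fun x => \sum_(i <- s) f i x)) /\
  \int[mu]_(x in A) (\sum_(i <- s) f i x) = \sum_(i <- s) \int[mu]_(x in A) f i x.
Proof.
move=> mA fi; elim: s => [|i s [IH1 IH2]].
  have -> : (fun x : R => \sum_(i <- [::]) f i x) = cst 0.
    by apply/funext => x; rewrite big_nil.
  split; first exact: integrable0.
  by rewrite big_nil Rintegral_cst// mul0r.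
have E : (fun x : R => \sum_(j <- i :: s) f j x) =
    (fun x => f i x + \sum_(j <- s) f j x).
  by apply/funext => x; rewrite big_cons.
split; first by rewrite E; exact: integrable_EFinD.
by rewrite E RintegralD// IH2 big_cons.
Qed.

(** Let q = sum_i |r_i| and Q its integral. The defect of the chain rule over a
    short interval having c as an endpoint is at most e times the integral of
    q over it: one half of e pays for the differentiability of H at
    x c, the other for the variation of the gradient of H along x.  By
    increment_le the total defect is at most e Q for every e > 0.  No
    derivative of x is ever taken. *)
Lemma Rintegral_chain_rule n (H : 'cV[R]_n -> R) (x r : R -> 'cV[R]_n) (a b : R) :
  a <= b ->
  (forall s t, a <= s -> s <= t -> t <= b -> forall i,
     mu.-integrable `[s, t] (EFin \o (fun u => r u i 0)) /\
     x t i 0 - x s i 0 = \int[mu]_(u in `[s, t]) r u i 0) ->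
  (forall t, a <= t <= b -> differentiable H (x t)) ->
  (forall i, {within `[a, b], continuous (fun t => 'D_(delta_mx i 0) H (x t))}) ->
  mu.-integrable `[a, b] (EFin \o (fun u => 'D_(r u) H (x u))) /\
  H (x b) - H (x a) = \int[mu]_(u in `[a, b]) 'D_(r u) H (x u).
Proof.
move=> ab xr dH cg.
pose g i t := 'D_(delta_mx i 0) H (x t).
pose rho t := \sum_(i < n) g i t * r t i 0.
pose q t := \sum_(i < n) `|r t i 0|.
have ri i : mu.-integrable `[a, b] (EFin \o (fun u => r u i 0)).
  by have [] := xr a b (lexx _) ab (lexx _) i.
have rhoi : mu.-integrable `[a, b] (EFin \o rho).
  apply: (Rintegral_sum _ _ _).1 => // i.
  exact: integrable_continuousM (ri i) (cg i).
have qi : mu.-integrable `[a, b] (EFin \o q).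
  apply: (Rintegral_sum _ _ _).1 => // i.
  exact: integrable_norm (ri i).
have rhoE u : u \in `[a, b]%classic -> rho u = 'D_(r u) H (x u).
  rewrite inE /= in_itv /= => aub; rewrite derive_partials; last exact: dH.
  by apply: eq_bigr => i _; exact: mulrC.
suff E : H (x b) - H (x a) = \int[mu]_(u in `[a, b]) rho u.
  split; last by rewrite E; apply: eq_Rintegral => u /rhoE.
  by apply: eq_integrable rhoi => // u /rhoE /= ->.
have xc i : {within `[a, b], continuous (fun t => x t i 0)}.
  apply: primitive_continuous ab (ri i) _ => t /andP[at_ tb].
  by have [] := xr a t (lexx _) at_ tb i.
pose Q := \int[mu]_(u in `[a, b]) q u.
suff key (e : R) : 0 < e ->
    `|H (x b) - H (x a) - \int[mu]_(u in `[a, b]) rho u| <= e * Q.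
  have Q0 : 0 <= Q by apply: Rintegral_ge0 => u _; exact: sumr_ge0.
  apply/eqP; rewrite -subr_eq0 -normr_le0; apply/ler_addgt0Pr => e e0.
  rewrite add0r (le_trans (key (e / (Q + 1)) _))//.
    by rewrite divr_gt0// ltr_wpDl.
  by rewrite mulrAC ler_pdivrMr ?ltr_wpDl// ler_wpM2l ?(ltW e0)// lerDl.
move=> e0.
pose D t := H (x t) - \int[mu]_(u in `[a, t]) rho u.
pose G t := e * \int[mu]_(u in `[a, t]) q u.
suff : `|D b - D a| <= G b - G a.
  rewrite /D /G set_itv1 !Rintegral_set1 mulr0 !subr0.
  by rewrite addrAC.
apply: increment_le => // c acb.
have e2 : 0 < e / 2 by rewrite divr_gt0.
have /nbhs_ballP[y0 /= y00 yP] := differentiable_eps (dH c acb) e2.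
have y20 : 0 < y0 / 2 by rewrite divr_gt0.
have : \forall t \near c, forall i : 'I_n, a <= t <= b ->
    `|g i t - g i c| <= e / 2 /\ `|x t i 0 - x c i 0| <= y0 / 2.
  apply: (@filter_forall _ _ (fun (i : 'I_n) t => a <= t <= b ->
    `|g i t - g i c| <= e / 2 /\ `|x t i 0 - x c i 0| <= y0 / 2)
    (nbhs c) (nbhs_filter c)) => i.
  have h1 := within_segment_near (cg i) acb e2.
  have h2 := within_segment_near (xc i) acb y20.
  by move: h1 h2; apply: filterS2 => t h1 h2 atb; split; [exact: h1|exact: h2].
move=> /nbhs_ballP[d /= d0 dP]; exists d => // s t as_ st tb sct std.
have near_c u : s <= u <= t -> a <= u <= b /\ ball c d u.
  move=> /andP[su ut]; split; first by rewrite (le_trans as_ su) (le_trans ut tb).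
  rewrite -ball_normE /= ltr_norml.
  by case: sct => [sc|tc]; apply/andP; split; lra.
have xnear u : s <= u <= t -> ball (x c) y0 (x u).
  move=> /near_c[aub /dP uP]; rewrite -ball_normE /= distrC.
  rewrite (@le_lt_trans _ _ (y0 / 2))//; last by rewrite ltr_pdivrMr// ltr_pMr// ltr1n.
  apply: norm_mx_le => [|i j]; first exact: ltW.
  by rewrite (ord1 j) !mxE; have [] := uP i aub.
have sub_int f : mu.-integrable `[a, b] (EFin \o f) ->
    mu.-integrable `[s, t] (EFin \o f) by exact: integrable_sub.
have spl f : mu.-integrable `[a, b] (EFin \o f) ->
    \int[mu]_(u in `[a, t]) f u - \int[mu]_(u in `[a, s]) f u =
    \int[mu]_(u in `[s, t]) f u.
  by move=> fi; apply: Rintegral_split => //; exact: integrable_sub fi.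
have -> : G t - G s = e * \int[mu]_(u in `[s, t]) q u.
  by rewrite /G -mulrBr spl.
have -> : D t - D s = H (x t) - H (x s) - \int[mu]_(u in `[s, t]) rho u.
  by rewrite -spl// /D; lra.
pose rc u := \sum_(i < n) g i c * r u i 0.
pose K := \int[mu]_(u in `[s, t]) rc u.
have rcii i : mu.-integrable `[s, t] (EFin \o (fun u => g i c * r u i 0)).
  by apply: integrable_EFinZ => //; exact: sub_int.
have [rci KE] := Rintegral_sum (index_enum 'I_n) (measurable_itv `[s, t]) rcii.
have xq : `|x t - x s| <= \int[mu]_(u in `[s, t]) q u.
  apply: norm_mx_le => [|i j]; first by apply: Rintegral_ge0 => u _; exact: sumr_ge0.
  rewrite (ord1 j) !mxE; have [rii ->] := xr s t as_ st tb i.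
  rewrite (le_trans (le_normr_Rintegral _ _))//.
  apply: le_Rintegral => //; [exact: integrable_norm|exact: sub_int|].
  by move=> u _; rewrite /q (bigD1 i)//= lerDl sumr_ge0.
(* Differentiability of H at x c; s or t is c, and the quantity bounded is odd
   under exchanging the two. *)
have A1 : `|H (x t) - H (x s) - K| <= e / 2 * `|x t - x s|.
  have KE' : K = 'd H (x c) (x t - x s).
    rewrite /K /rc KE -deriveE; last exact: dH.
    rewrite derive_partials; last exact: dH.
    apply: eq_bigr => i _; rewrite RintegralZl//; last exact: sub_int.
    by have [_ <-] := xr s t as_ st tb i; rewrite !mxE mulrC.
  rewrite KE'.
  case: sct => [sc|tc].
    have := yP _ (xnear t _); rewrite -sc lexx st; exact.
  have := yP _ (xnear s _); rewrite -tc lexx st => /(_ isT).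
  rewrite -[x s - x t]opprB linearN opprK normrN.
  move: ('d H (x t) (x t - x s)) (H (x t)) (H (x s)) => L h1 h2.
  have -> : `|h1 - h2 - (L : R)| = `|h2 - h1 + L| :> R by rewrite -normrN; congr (`| _ |); ring.
  by [].
(* Variation of the gradient between c and the other points of [s, t]. *)
have A2 : `|K - \int[mu]_(u in `[s, t]) rho u| <= e / 2 * \int[mu]_(u in `[s, t]) q u.
  have qst := sub_int _ qi; have rhost := sub_int _ rhoi.
  rewrite /K -RintegralB// (le_trans (le_normr_Rintegral _ _))//.
    exact: integrable_EFinB.
  rewrite -RintegralZl//; apply: le_Rintegral => //.
  - by apply: integrable_norm => //; exact: integrable_EFinB.
  - exact: integrable_EFinZ.
  move=> u; rewrite /= in_itv /= => sut.
  have [aub /dP uP] := near_c u sut.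
  rewrite /rc /rho /q -sumrB mulr_sumr (le_trans (ler_norm_sum _ _ _))//.
  apply: ler_sum => i _; rewrite -mulrBl normrM ler_wpM2r// distrC.
  by have [] := uP i aub.
have : `|H (x t) - H (x s) - \int[mu]_(u in `[s, t]) rho u| <=
    `|H (x t) - H (x s) - K| + `|K - \int[mu]_(u in `[s, t]) rho u|.
  by rewrite (le_trans _ (ler_normD _ _))// addrA subrK.
move=> /le_trans; apply.
have e20 : 0 <= e / 2 by exact: ltW.
apply: le_trans (lerD A1 A2) _.
by rewrite {3}(splitr e) mulrDl lerD2r ler_wpM2l.
Qed.

End IntegralChainRule.

(** * Trajectories in the two coordinate systems *)

Section Trajectories.
Variable R : realType.
Local Notation mu := (@lebesgue_measure R).

Definition primitive_on n (x r : R -> 'cV[R]_n) (a b : R) : Prop :=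
  forall s t, a <= s -> s <= t -> t <= b -> forall i,
    mu.-integrable `[s, t] (EFin \o (fun u => r u i 0)) /\
    x t i 0 - x s i 0 = \int[mu]_(u in `[s, t]) r u i 0.

Lemma primitive_on_ext n (x x' r r' : R -> 'cV[R]_n) (a b : R) :
  (forall t, a <= t <= b -> x t = x' t /\ r t = r' t) ->
  primitive_on x r a b -> primitive_on x' r' a b.
Proof.
move=> E xr s t as_ st tb i; have [ri xE] := xr s t as_ st tb i.
have [<- _] : x t = x' t /\ r t = r' t by apply: E; rewrite tb (le_trans as_).
have [<- _] : x s = x' s /\ r s = r' s by apply: E; rewrite as_ (le_trans st).
have rr u : u \in `[s, t]%classic -> r u i 0 = r' u i 0.
  rewrite inE /= in_itv /= => /andP[su ut].
  by have [|_ ->//] := E u; rewrite (le_trans as_ su) (le_trans ut tb).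
split; last by rewrite xE; apply: eq_Rintegral => u /rr.
by apply: eq_integrable ri => // u /rr /= ->.
Qed.

Lemma continuous_along n (x : R -> 'cV[R]_n) (K : 'cV[R]_n -> R) (a b : R) :
  (forall i, {within `[a, b], continuous (fun t => x t i 0)}) ->
  (forall t, a <= t <= b -> {for x t, continuous K}) ->
  {within `[a, b], continuous (fun t => K (x t))}.
Proof.
move=> cx cK; apply/subspace_continuousP => c /=; rewrite in_itv /= => acb P.
move=> /(cK c acb) /= /nbhs_ballP[e /= e0 eP].
have e2 : 0 < e / 2 by rewrite divr_gt0.
have : \forall t \near c, forall i : 'I_n, a <= t <= b -> `|x t i 0 - x c i 0| <= e / 2.
  apply: (@filter_forall _ _ (fun (i : 'I_n) t => a <= t <= b ->
    `|x t i 0 - x c i 0| <= e / 2) (nbhs c) (nbhs_filter c)) => i.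
  exact: within_segment_near (cx i) acb e2.
move=> xe; suff : \forall t \near within `[a, b] (nbhs c), P (K (x t)) by [].
rewrite near_withinE; apply: filterS xe => t tP /=; rewrite in_itv /= => atb.
apply: eP; rewrite -ball_normE /= distrC.
rewrite (@le_lt_trans _ _ (e / 2))//; last by rewrite ltr_pdivrMr// ltr_pMr// ltr1n.
apply: norm_mx_le => [|i j]; first exact: ltW.
by rewrite (ord1 j) !mxE; exact: tP.
Qed.

Lemma primitive_on_image n p (A : set 'cV[R]_n) (F : 'cV[R]_n -> 'cV[R]_p)
    (x r : R -> 'cV[R]_n) (a b : R) :
  open A -> smooth_on A F -> (forall t, a <= t <= b -> A (x t)) ->
  primitive_on x r a b ->
  primitive_on (F \o x) (fun t => jacobian_mx F (x t) *m r t) a b.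
Proof.
move=> oA sF xA xr s t as_ st tb i.
have xAst u : s <= u <= t -> A (x u).
  by move=> /andP[su ut]; apply: xA; rewrite (le_trans as_ su) (le_trans ut tb).
pose H y := F y i 0.
have sH : smooth_on A H by exact: smooth_on_coord.
have xrst : primitive_on x r s t.
  by move=> s' t' ss' st' tt'; apply: xr => //; [exact: le_trans ss'|exact: le_trans tb].
have cx j : {within `[s, t], continuous (fun t => x t j 0)}.
  apply: (@primitive_continuous _ _ (fun u => r u j 0)) => //.
    by have [] := xrst s t (lexx _) st (lexx _) j.
  by move=> u /andP[su ut]; have [] := xrst s u (lexx _) su ut j.
have [] := @Rintegral_chain_rule R n H x r s t st xrst.
- by move=> u /xAst Au; exact: smooth_on_differentiable sH Au.
- move=> j; apply: (@continuous_along n x ('D_(delta_mx j 0) H) s t cx) => u /xAst Au.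
  apply: differentiable_continuous; apply: smooth_on_differentiable Au.
  exact: smooth_on_derive.
have E u : u \in `[s, t]%classic -> 'D_(r u) H (x u) = (jacobian_mx F (x u) *m r u) i 0.
  rewrite inE /= in_itv /= => /xAst Au.
  have dF := smooth_on_differentiable sF Au.
  by rewrite -derive_jacobian// derive_coord.
move=> Hi HE; split; last by rewrite [LHS]HE; apply: eq_Rintegral => u /E.
by apply: eq_integrable Hi => // u /E /= ->.
Qed.

Lemma trajectoryE n m p (S : control_affine R n m p) (tf : R) u x :
  trajectory S `[0, tf] u x <->
  primitive_on x (fun t => sys_f S (x t) + sys_g S (x t) *m u t) 0 tf.
Proof.
split=> h.
  move=> s t s0 st tt i; apply: h => //=; rewrite in_itv /=.
    by rewrite s0 (le_trans st).
  by rewrite tt (le_trans s0).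
move=> s t /=; rewrite !in_itv /= => s0t t0t st i.
apply: h => //; first by case/andP: s0t.
by case/andP: t0t.
Qed.

(** The velocity of z is J^-1 times that of Phi o z, where J is the Jacobian of
    Phi at z: apply primitive_on_image to Psi in one direction and to Phi in the
    other. *)
Lemma trajectory_balanced n m p (S : control_affine R n m p)
    (Phi Psi : 'cV[R]_n -> 'cV[R]_n) (U V : set 'cV[R]_n) (x0 : 'cV[R]_n)
    (tf : R) (u : R -> 'cV[R]_m) (z : R -> 'cV[R]_n) :
  local_inverse Phi Psi U V -> V x0 -> 0 < tf ->
  (forall t, `[0, tf]%classic t -> U (z t)) ->
  trajectory S `[0, tf] u (Phi \o z) /\ Phi (z 0) = x0 <->
  trajectory (balanced_realization S Phi) `[0, tf] u z /\ z 0 = Psi x0.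
Proof.
move=> inv Vx0 tf0 zU'; have zU (t : R) : 0 <= t <= tf -> U (z t).
  by move=> t0; apply: zU'; rewrite /= in_itv.
move: (inv) => [[oU U0] [oV V0] [sPhi uPhi] UP VP].
have init : Phi (z 0) = x0 <-> z 0 = Psi x0.
  split=> [<-|->]; last by have [] := VP _ Vx0.
  by have [|_ ->//] := UP (z 0); apply: zU; rewrite lexx ltW.
rewrite !trajectoryE init; split=> -[tr z0]; split=> //.
  have xV (t : R) : 0 <= t <= tf -> V ((Phi \o z) t) by move=> /zU /UP[].
  have := primitive_on_image oV (inverse_smooth inv) xV tr.
  apply: primitive_on_ext => t /zU Uz; have [Vz Psiz] := UP _ Uz.
  split=> //=.
  rewrite -derive_jacobian; last exact: smooth_on_differentiable (inverse_smooth inv) Vz.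
  by rewrite (inverse_derive inv)// Psiz mulmxDr mulmxA.
have := primitive_on_image oU sPhi zU tr.
apply: primitive_on_ext => t /zU Uz; split=> //=.
by rewrite -mulmxA -mulmxDr mulKVmx// uPhi.
Qed.

End Trajectories.

(** * Kronecker powers *)

Section KroneckerAlgebra.
Variables (R : realType) (n : nat).
Local Notation V := 'cV[R]_n.

(** The two typings n * n ^ p and n ^ p.+1 are only propositionally equal; all
    casts between them are confined to this product and to tens_cat, and
    ktens_entry hides the indexing. *)
Definition ktens p (u : V) (v : 'cV[R]_(n ^ p)) : 'cV[R]_(n ^ p.+1) :=
  castmx (esym (expnS n p), erefl) (u *t v : 'cV[R]_(n * n ^ p)).

Lemma ktens_entry p (i : 'I_(n ^ p.+1)) : exists (a : 'I_n) (b : 'I_(n ^ p)),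
  forall u v, ktens u v i 0 = u a 0 * v b 0.
Proof.
exists (mxtens_unindex (cast_ord (expnS n p) i)).1.
exists (mxtens_unindex (cast_ord (expnS n p) i)).2 => u v.
rewrite /ktens castmxE mxE !ord1 esymK.
by congr (u _ _ * v _ _); exact: val_inj.
Qed.

Lemma ktensBl p u u' (v : 'cV[R]_(n ^ p)) : ktens (u - u') v = ktens u v - ktens u' v.
Proof.
apply/matrixP => i j; rewrite (ord1 j); have [a [b E]] := ktens_entry i.
by rewrite !mxE !E !mxE mulrBl.
Qed.

Lemma ktensBr p u (v v' : 'cV[R]_(n ^ p)) : ktens u (v - v') = ktens u v - ktens u v'.
Proof.
apply/matrixP => i j; rewrite (ord1 j); have [a [b E]] := ktens_entry i.
by rewrite !mxE !E !mxE mulrBr.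
Qed.

Lemma ktens0r p u : ktens u (0 : 'cV[R]_(n ^ p)) = 0.
Proof. by rewrite -[X in ktens _ X](subrr 0) ktensBr subrr. Qed.

Lemma ktens_suml p I (s : seq I) (Q : pred I) (f : I -> V) (v : 'cV[R]_(n ^ p)) :
  ktens (\sum_(i <- s | Q i) f i) v = \sum_(i <- s | Q i) ktens (f i) v.
Proof.
apply/matrixP => i j; rewrite (ord1 j); have [a [b E]] := ktens_entry i.
rewrite summxE E summxE mulr_suml; apply: eq_bigr => k _.
by rewrite E.
Qed.

Lemma ktens_sumr p I (s : seq I) (Q : pred I) u (f : I -> 'cV[R]_(n ^ p)) :
  ktens u (\sum_(i <- s | Q i) f i) = \sum_(i <- s | Q i) ktens u (f i).
Proof.
apply/matrixP => i j; rewrite (ord1 j); have [a [b E]] := ktens_entry i.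
rewrite summxE E summxE mulr_sumr; apply: eq_bigr => k _.
by rewrite E.
Qed.

Lemma ktens_norm p u (v : 'cV[R]_(n ^ p)) : `|ktens u v| <= `|u| * `|v|.
Proof.
apply: norm_mx_le => [|i j]; first by rewrite mulr_ge0.
rewrite (ord1 j); have [a [b E]] := ktens_entry i.
by rewrite E normrM ler_pM ?coord_le_norm.
Qed.

Lemma kron_pow0 (x : V) : kron_pow x 0 = 1%:M.
Proof. by apply/matrixP => i j; rewrite castmxE !mxE !ord1. Qed.

Lemma kron_pow1 (x : V) : kron_pow x 1 = x.
Proof.
by apply/matrixP => i j; rewrite castmxE ntensmx1; congr (x _ _); apply: val_inj => //=; rewrite !ord1.
Qed.

Lemma kron_powS (x : V) p : kron_pow x p.+1 = ktens x (kron_pow x p).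
Proof.
case: p => [|p].
  apply/matrixP => i j; rewrite kron_pow1 /ktens castmxE mxE kron_pow0 mxE.
  rewrite !ord1 /= mulr1; congr (x _ _); apply: val_inj => /=.
  by rewrite expn0 divn1.
apply/matrixP => i j; rewrite (ord1 j) /ktens !castmxE ntensmxSS !mxE castmxE.
congr (_ * _); first by congr (x _ _); apply: val_inj => //=; rewrite div0n.
by congr ((x ^t p.+1) _ _); apply: val_inj => //=; rewrite mod0n.
Qed.

Lemma kron_pow_norm (x : V) p : `|kron_pow x p| <= `|x| ^+ p.
Proof.
elim: p => [|p IHp].
  rewrite kron_pow0 expr0; apply: norm_mx_le => // i j.
  by rewrite mxE !ord1 eqxx normr1.
rewrite kron_powS (le_trans (ktens_norm _ _))// exprS ler_wpM2l//.
Qed.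

Lemma kron_powZ (t : R) (x : V) p : kron_pow (t *: x) p = t ^+ p *: kron_pow x p.
Proof.
elim: p => [|p IHp]; first by rewrite !kron_pow0 expr0 scale1r.
rewrite !kron_powS IHp; apply/matrixP => i j; rewrite (ord1 j).
have [a [b E]] := ktens_entry i.
by rewrite mxE !E !mxE exprS; ring.
Qed.

Definition tens_cat i m (A : 'cV[R]_(n ^ i)) (B : 'cV[R]_(n ^ m)) : 'cV[R]_(n ^ (i + m)) :=
  castmx (esym (expnD n i m), erefl) (A *t B : 'cV[R]_(n ^ i * n ^ m)).

(** Both sides read the same digits of the index k in base n, split in two
    different orders. *)
Lemma ktensA i m u (A : 'cV[R]_(n ^ i)) (B : 'cV[R]_(n ^ m)) :
  ktens u (tens_cat A B) = tens_cat (ktens u A) B :> 'cV[R]_(n ^ (i + m).+1).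
Proof.
apply/matrixP => k j; rewrite (ord1 j).
rewrite /ktens /tens_cat (castmxE (esym (expnS n (i + m)), erefl)).
rewrite mxE castmxE mxE.
rewrite (castmxE (esym (expnD n i.+1 m), erefl)) mxE castmxE mxE mulrA.
congr (_ * _); [congr (_ * _); [congr (u _ _)|congr (A _ _)]|congr (B _ _)];
  apply: val_inj => //=.
- by rewrite expnD mulnC divnMA.
- by rewrite modn_divl expnD.
- by rewrite expnD modn_dvdm// dvdn_mull.
Qed.

Lemma kron_powD (x : V) i m :
  kron_pow x (i + m) = tens_cat (kron_pow x i) (kron_pow x m).
Proof.
elim: i => [|i IHi].
  apply/matrixP => k j; rewrite (ord1 j) [RHS]castmxE [RHS]mxE kron_pow0 mxE !ord1 mul1r.
  congr (kron_pow x m _ _); apply: val_inj => //=.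
  by rewrite modn_small.
have E : kron_pow x (i.+1 + m) = ktens x (kron_pow x (i + m)) := kron_powS x (i + m).
by rewrite E IHi ktensA -kron_powS.
Qed.

Lemma ntensmx_ktens (A : 'M[R]_n) p u (v : 'cV[R]_(n ^ p)) :
  A ^t p.+1 *m ktens u v = ktens (A *m u) (A ^t p *m v).
Proof.
case: p v => [|p] v.
  have E w (y : 'cV[R]_(n ^ 0)) : ktens w y = y 0 0 *: w.
    apply/matrixP => i j; rewrite (ord1 j) /ktens castmxE mxE mxE mulrC.
    congr (_ * _); first by congr (y _ _); apply: val_inj; rewrite ?ord1.
    by congr (w _ _); apply: val_inj => //=; rewrite expn0 divn1.
  by rewrite !E ntensmx1 ntensmx0 mul1mx scalemxAr.
rewrite ntensmxSS /ktens -tensmx_mul.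
by rewrite (_ : esym _ = erefl) //; exact: eq_irrelevance.
Qed.

Lemma ntensmx_kron_pow (A : 'M[R]_n) (x : V) p :
  A ^t p *m kron_pow x p = kron_pow (A *m x) p.
Proof.
elim: p => [|p IHp]; first by rewrite !kron_pow0 ntensmx0 mul1mx.
by rewrite !kron_powS ntensmx_ktens IHp.
Qed.

End KroneckerAlgebra.

(** * The tensor sums and the recursion for the inverse *)

Section TensorSums.
Variables (R : realType) (n : nat) (T : forall k : nat, 'M[R]_(n, n ^ k)).
Local Notation V := 'cV[R]_n.

(** The value at z of the q-homogeneous part of the p-fold tensor power of the
    series. *)
Definition tensor_part (p q : nat) (z : V) : 'cV[R]_(n ^ p) :=
  tensor_sum T p q *m kron_pow z q.

Lemma castmx_mulmx m m' k k' l l' (em : m = m') (ek : k = k') (el : l = l')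
    (A : 'M[R]_(m, k)) (B : 'M[R]_(k, l)) :
  castmx (em, ek) A *m castmx (ek, el) B = castmx (em, el) (A *m B).
Proof. by case: _ / em; case: _ / ek; case: _ / el; rewrite !castmx_id. Qed.

Lemma kron_seq_cons_kron_pow p q i s (z : V) :
  size s = p -> sumn s = q ->
  (conform_mx 0 (kron_seq T (i :: s)) : 'M[R]_(n ^ p.+1, n ^ (i + q))) *m kron_pow z (i + q) =
  ktens (T i *m kron_pow z i)
    ((conform_mx 0 (kron_seq T s) : 'M[R]_(n ^ p, n ^ q)) *m kron_pow z q).
Proof.
move=> <- <-; rewrite !conform_mx_id kron_powD /ktens -tensmx_mul /=.
exact: castmx_mulmx.
Qed.

(** A part of a composition of q is at most q, so any bound M >= q on the parts
    yields the same compositions. *)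
Lemma compositions_widen (W : nmodType) p q M (G : seq nat -> W) : (q <= M)%N ->
  \sum_(c : p.-tuple 'I_M.+1 | all (fun i : 'I_M.+1 => (0 < i)%N) c &&
     (sumn [seq val i | i <- c] == q)) G [seq val i | i <- c] =
  \sum_(c : p.-tuple 'I_q.+1 | all (fun i : 'I_q.+1 => (0 < i)%N) c &&
     (sumn [seq val i | i <- c] == q)) G [seq val i | i <- c].
Proof.
move=> qM.
have le_sumn (s : seq nat) k : k \in s -> (k <= sumn s)%N.
  elim: s => // a s IHs; rewrite inE => /predU1P[->|/IHs ks] /=; first exact: leq_addr.
  exact: leq_trans ks (leq_addl _ _).
pose h (c : p.-tuple 'I_q.+1) : p.-tuple 'I_M.+1 := [tuple of map (fun i : 'I_q.+1 => inord i) c].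
pose h' (c : p.-tuple 'I_M.+1) : p.-tuple 'I_q.+1 := [tuple of map (fun i : 'I_M.+1 => inord i) c].
have hval (c : p.-tuple 'I_q.+1) : [seq val i | i <- h c] = [seq val i | i <- c].
  rewrite /= -map_comp; apply: eq_map => i /=; rewrite inordK//.
  by rewrite ltnS (leq_trans _ qM)// -ltnS.
have h'val (c : p.-tuple 'I_M.+1) : sumn [seq val i | i <- c] = q -> [seq val i | i <- h' c] = [seq val i | i <- c].
  move=> cq; rewrite /= -map_comp; apply/eq_in_map => i ic /=; rewrite inordK//.
  by rewrite ltnS -cq; apply: le_sumn; exact: map_f.
have posE M' (c : p.-tuple 'I_M'.+1) : all (fun i : 'I_M'.+1 => (0 < i)%N) c =
    all (fun k => (0 < k)%N) [seq val i | i <- c] by rewrite all_map.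
rewrite (reindex_onto h h') /=; last first.
  move=> c /andP[_ /eqP cq]; apply/val_inj/(inj_map val_inj).
  by rewrite hval h'val.
apply: eq_big => [c|c _]; last by rewrite -hval.
rewrite !posE -/(h c) hval.
case: eqP => [cq|]; last by rewrite andbF.
rewrite andbT; case: (all _ _) => //=; apply/eqP/val_inj/(inj_map val_inj).
by rewrite h'val ?hval.
Qed.

Lemma tensor_partE p q M (z : V) : (q <= M)%N ->
  tensor_part p q z = \sum_(c : p.-tuple 'I_M.+1 | all (fun i : 'I_M.+1 => (0 < i)%N) c &&
     (sumn [seq val i | i <- c] == q))
    (conform_mx 0 (kron_seq T [seq val i | i <- c]) : 'M[R]_(n ^ p, n ^ q)) *m kron_pow z q.
Proof.
move=> qM; rewrite /tensor_part /tensor_sum mulmx_suml.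
by rewrite (compositions_widen p (fun s => (conform_mx 0 (kron_seq T s) :
  'M[R]_(n ^ p, n ^ q)) *m kron_pow z q) qM).
Qed.

(** Split a composition of q into its first part i and a composition of
    q - i.  This is the rule for the q-homogeneous part of a product of a series
    with its p-th tensor power. *)
Lemma tensor_partS p q (z : V) : tensor_part p.+1 q z =
  \sum_(i < q.+1 | (0 < i)%N) ktens (T i *m kron_pow z i) (tensor_part p (q - i) z).
Proof.
pose F s : 'cV[R]_(n ^ p.+1) :=
  (conform_mx 0 (kron_seq T s) : 'M[R]_(n ^ p.+1, n ^ q)) *m kron_pow z q.
rewrite (tensor_partE _ _ (leqnn q)).
rewrite (reindex (fun ic : 'I_q.+1 * p.-tuple 'I_q.+1 => [tuple of ic.1 :: ic.2])) /=; last first.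
  exists (fun c : p.+1.-tuple 'I_q.+1 => (thead c, [tuple of behead c])).
    by move=> [i c] _ /=; congr (_, _); apply: val_inj.
  by move=> c _; rewrite -tuple_eta.
transitivity (\sum_(i < q.+1 | (0 < i)%N)
   \sum_(c : p.-tuple 'I_q.+1 | all (fun i : 'I_q.+1 => (0 < i)%N) c &&
     (sumn [seq val i | i <- c] == q - i)%N) F (val i :: [seq val i | i <- c])).
  rewrite pair_big_dep /=; apply: eq_bigl => -[i c] /=.
  rewrite -andbA; congr (_ && (_ && _)).
  by rewrite -[in RHS](eqn_add2l i) subnKC// -ltnS.
apply: eq_bigr => i i0; have iq : (i <= q)%N by rewrite -ltnS.
rewrite (tensor_partE _ _ (leq_subr i q)) ktens_sumr; apply: eq_bigr => c /andP[_ /eqP cq].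
rewrite -kron_seq_cons_kron_pow//; last by rewrite size_map size_tuple.
by rewrite /F; move: (i + (q - i))%N (subnKC iq) => q' E; subst q'.
Qed.

Lemma tensor_part00 z : tensor_part 0 0 z = 1%:M.
Proof.
rewrite /tensor_part kron_pow0 mulmx1 /tensor_sum (bigD1 [tuple])//= big1 ?addr0.
  by rewrite conform_mx_id.
by move=> c /andP[_ /eqP[]]; rewrite (tuple0 c).
Qed.

Lemma tensor_part0S q z : tensor_part 0 q.+1 z = 0.
Proof.
rewrite /tensor_part /tensor_sum big1 ?mul0mx// => c.
by rewrite (tuple0 c).
Qed.

Lemma tensor_part_lt p q z : (q < p)%N -> tensor_part p q z = 0.
Proof.
elim: p q => // p IHp q qp; rewrite tensor_partS big1// => i i0.
rewrite IHp ?ktens0r// ltn_subLR; last by rewrite -ltnS.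
by rewrite (leq_trans qp)// -[p.+1]add1n leq_add2r.
Qed.

(** The only composition of p into p positive parts is 1 + ... + 1. *)
Lemma tensor_part_diag p z : tensor_part p p z = kron_pow (T 1 *m kron_pow z 1) p.
Proof.
elim: p => [|p IHp]; first by rewrite tensor_part00 kron_pow0.
rewrite tensor_partS kron_powS -IHp.
rewrite (bigD1 (inord 1 : 'I_p.+2)) /=; last by rewrite inordK.
rewrite big1 ?addr0 => [|i /andP[i0 i1]]; first by rewrite inordK// subSS subn0.
rewrite tensor_part_lt ?ktens0r// ltn_subLR; last by rewrite -ltnS.
suff i2 : (1 < i)%N by exact: leq_add i2 (leqnn p).
rewrite ltn_neqAle i0 andbT.
by apply: contra i1 => /eqP i1; apply/eqP/val_inj; rewrite /= inordK.
Qed.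

(** The series P is a formal left inverse of T: in degree q >= 2 the term j = q
    is P_q (T_1)^q z^q, in which P_1^q cancels T_1^q, leaving minus the sum of
    the terms j < q. *)
Lemma inverse_coefficients_tensor_part (P : forall k : nat, 'M[R]_(n, n ^ k)) q (z : V) :
  (T 1%N : 'M[R]_n) \in unitmx -> inverse_coefficients T P -> (0 < q)%N ->
  \sum_(1 <= j < q.+1) P j *m tensor_part j q z = if q == 1%N then z else 0.
Proof.
move=> uT [P1 PS] q0; rewrite big_nat_recr//= tensor_part_diag.
have [->|q1] := eqVneq q 1%N.
  rewrite big_geq// add0r !kron_pow1 P1.
  by rewrite (mulKmx uT).
rewrite PS; last by case: q q0 q1 => [|[]].
rewrite -mulmxA ntensmx_kron_pow P1 kron_pow1 (mulKmx uT) mulNmx mulmx_suml.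
by rewrite -sumrB big1// => j _; rewrite /tensor_part mulmxA subrr.
Qed.

End TensorSums.

(** * Orders of vanishing at the origin *)

Section VanishingOrder.
Variables (R : realType) (n : nat).
Local Notation V := 'cV[R]_n.

Definition vanishes_to_order (N : nat) k (F : V -> 'cV[R]_k) : Prop :=
  exists2 C : R, 0 <= C & \forall z \near (0 : V), `|F z| <= C * `|z| ^+ N.

Lemma vanishes_eq N k (F G : V -> 'cV[R]_k) : F =1 G ->
  vanishes_to_order N F -> vanishes_to_order N G.
Proof. by move=> /funext ->. Qed.

Lemma near0W (P : V -> Prop) : (forall z, P z) -> \forall z \near (0 : V), P z.
Proof. by move=> Pz; apply/nbhs_ballP; exists 1 => //= z _. Qed.

Lemma near0_norm_lt (e : R) : 0 < e -> \forall z \near (0 : V), `|z| < e.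
Proof.
move=> e0; apply/nbhs_ballP; exists e => //= z.
by rewrite -ball_normE /= sub0r normrN.
Qed.

Lemma vanishesW N M k (F : V -> 'cV[R]_k) : (M <= N)%N ->
  vanishes_to_order N F -> vanishes_to_order M F.
Proof.
move=> MN [C C0 CP]; exists C => //.
move: CP (near0_norm_lt ltr01); apply: filterS2 => z zC z1.
by rewrite (le_trans zC)// ler_wpM2l// ler_wiXn2l// ltW.
Qed.

Lemma vanishes0 N k : vanishes_to_order N (fun=> 0 : 'cV[R]_k).
Proof. by exists 0 => //; apply: near0W => z; rewrite normr0 mul0r. Qed.

Lemma vanishesD N k (F G : V -> 'cV[R]_k) :
  vanishes_to_order N F -> vanishes_to_order N G ->
  vanishes_to_order N (fun z => F z + G z).
Proof.
move=> [C C0 CP] [D D0 DP]; exists (C + D); first exact: addr_ge0.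
move: CP DP; apply: filterS2 => z h1 h2.
by rewrite (le_trans (ler_normD _ _))// mulrDl lerD.
Qed.

Lemma vanishes_sum N k I (s : seq I) (Q : pred I) (F : I -> V -> 'cV[R]_k) :
  (forall i, Q i -> vanishes_to_order N (F i)) ->
  vanishes_to_order N (fun z => \sum_(i <- s | Q i) F i z).
Proof.
move=> FN; elim: s => [|i s IHs].
  by apply: vanishes_eq (vanishes0 N k) => z; rewrite big_nil.
case Qi : (Q i); last by apply: vanishes_eq IHs => z; rewrite big_cons Qi.
apply: vanishes_eq (vanishesD (FN i Qi) IHs) => z.
by rewrite big_cons Qi.
Qed.

Lemma vanishes_mulmx N k l (A : 'M[R]_(l, k)) (F : V -> 'cV[R]_k) :
  vanishes_to_order N F -> vanishes_to_order N (fun z => A *m F z).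
Proof.
move=> [C C0 CP]; have [D D0 DP] := mulmx_bound A.
exists (D * C); first by rewrite mulr_ge0// ltW.
move: CP; apply: filterS => z zC; rewrite (le_trans (DP _))//.
by rewrite -mulrA ler_wpM2l// ltW.
Qed.

Lemma vanishes_ktens N M p (F : V -> V) (G : V -> 'cV[R]_(n ^ p)) :
  vanishes_to_order N F -> vanishes_to_order M G ->
  vanishes_to_order (N + M) (fun z => ktens (F z) (G z)).
Proof.
move=> [C C0 CP] [D D0 DP]; exists (C * D); first exact: mulr_ge0.
move: CP DP; apply: filterS2 => z h1 h2.
by rewrite (le_trans (ktens_norm _ _))// exprD mulrACA ler_pM.
Qed.

Lemma vanishes_kron_pow p : vanishes_to_order p (fun z : V => kron_pow z p).
Proof. by exists 1 => //; apply: near0W => z; rewrite mul1r kron_pow_norm. Qed.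

Lemma vanishes_tensor_part (T : forall k : nat, 'M[R]_(n, n ^ k)) p q :
  vanishes_to_order q (tensor_part T p q).
Proof. exact: vanishes_mulmx (vanishes_kron_pow q). Qed.

Lemma vanishes_kron_pow_comp p (F : V -> V) : vanishes_to_order 0 F ->
  vanishes_to_order 0 (fun z => kron_pow (F z) p).
Proof.
move=> F0; elim: p => [|p IHp].
  by apply: vanishes_eq (vanishes_kron_pow 0) => z; rewrite !kron_pow0.
by apply: vanishes_eq (vanishes_ktens F0 IHp) => z; rewrite kron_powS.
Qed.

Lemma vanishes_comp N k (F : V -> 'cV[R]_k) (G : V -> V) (C : R) :
  0 <= C -> (\forall y \near (0 : V), `|G y| <= C * `|y|) ->
  vanishes_to_order N F -> vanishes_to_order N (F \o G).
Proof.
move=> C0 GC [D D0 DP]; exists (D * C ^+ N); first by rewrite mulr_ge0// exprn_ge0.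
have /nbhs_ballP[e /= e0 eP] := DP.
have e1 : 0 < e / (C + 1) by rewrite divr_gt0// ltr_wpDl.
move: GC (near0_norm_lt e1); apply: filterS2 => y yC ye.
have Ge : `|G y| < e.
  rewrite (le_lt_trans yC)//; move: ye; rewrite ltr_pdivlMr ?ltr_wpDl// => ye.
  by rewrite (le_lt_trans _ ye)// mulrC ler_wpM2l// lerDl.
have /= := eP (G y); rewrite -ball_normE /= sub0r normrN => /(_ Ge) /le_trans; apply.
by rewrite -mulrA -exprMn ler_wpM2l// lerXn2r// ?nnegrE// mulr_ge0.
Qed.

(** Letting t tend to 0 gives c 0 = 0; then divide by t. *)
Lemma poly_coefs_vanish N (c : nat -> R) (C d : R) : 0 < d ->
  (forall t, 0 < t < d -> `|\sum_(k < N) c k * t ^+ k| <= C * t ^+ N) ->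
  forall k, (k < N)%N -> c k = 0.
Proof.
move=> d0; elim: N c => // N IHN c cN.
pose D := \sum_(k < N) `|c k.+1|.
have D0 : 0 <= D by exact: sumr_ge0.
(* Evaluate at d / 2: only a nonnegative C can bound a norm. *)
have C0 : 0 <= C.
  have d2 : 0 < d / 2 < d by rewrite divr_gt0//= ltr_pdivrMr// ltr_pMr// ltr1n.
  have := le_trans (normr_ge0 _) (cN _ d2).
  by rewrite pmulr_lge0// exprn_gt0//; case/andP: d2.
have c00 : c 0%N = 0.
  apply/eqP; rewrite -normr_le0; apply/ler_addgt0Pr => /= e e0; rewrite add0r.
  have K0 : 0 < C + D + 1 by rewrite ltr_wpDl// addr_ge0.
  (* Below d for the hypothesis, at most 1 to absorb higher powers of t, and
     small enough that (C + D) t <= e. *)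
  pose t := Num.min (Num.min (d / 2) 1) (e / (C + D + 1)).
  have t0 : 0 < t by rewrite !lt_min !divr_gt0// ltr01.
  have td : t <= d / 2 by rewrite !ge_min lexx.
  have t1 : t <= 1 by rewrite !ge_min lexx orbT.
  have te : t <= e / (C + D + 1) by rewrite ge_min lexx orbT.
  have tN k : t ^+ k.+1 <= t.
    by rewrite exprS ler_piMr ?(ltW t0)//; apply: exprn_ile1 => //; exact: ltW.
  have td' : 0 < t < d by rewrite t0 (le_lt_trans td)// ltr_pdivrMr// ltr_pMr// ltr1n.
  have := cN t td'; rewrite big_ord_recl expr0 mulr1 => h.
  have hs : `|\sum_(i < N) c (lift ord0 i) * t ^+ lift ord0 i| <= D * t.
    rewrite (le_trans (ler_norm_sum _ _ _))// mulr_suml; apply: ler_sum => k _.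
    by rewrite normrM (ger0_norm (exprn_ge0 _ (ltW t0))) ler_wpM2l//; exact: tN.
  have : `|c 0%N| <= C * t + D * t.
    rewrite -[c 0%N](addrK (\sum_(i < N) c (lift ord0 i) * t ^+ lift ord0 i)).
    rewrite (le_trans (ler_normB _ _))// lerD// (le_trans h)//.
    by rewrite ler_wpM2l.
  move/le_trans; apply; rewrite -mulrDl.
  move: te; rewrite ler_pdivlMr// mulrC => te; apply: le_trans te.
  by rewrite ler_wpM2r ?(ltW t0)// lerDl.
case=> [//|k]; rewrite ltnS => kN; apply: (IHN (fun k => c k.+1)) => // t td.
have := cN t td; case/andP: td => t0 td.
rewrite big_ord_recl c00 mul0r add0r exprSr mulrA.
under eq_bigr do rewrite exprSr mulrA.
by rewrite -mulr_suml normrM (gtr0_norm t0) ler_pM2r.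
Qed.

Lemma homogeneous_parts_unique N k (c : nat -> V -> 'cV[R]_k) :
  (forall j t x, c j (t *: x) = t ^+ j *: c j x) ->
  vanishes_to_order N (fun x => \sum_(j < N) c j x) ->
  forall j x, (j < N)%N -> c j x = 0.
Proof.
move=> hc [C C0 CP] j x jN; apply/matrixP => a b; rewrite (ord1 b) mxE.
have /nbhs_ballP[e /= e0 eP] := CP.
have x1 : 0 < `|x| + 1 by rewrite ltr_wpDl.
apply: (@poly_coefs_vanish N (fun j => c j x a 0) (C * `|x| ^+ N) (e / (`|x| + 1))) => //.
  by rewrite divr_gt0.
move=> t /andP[t0 te].
have /= := eP (t *: x); rewrite -ball_normE /= sub0r normrN normrZ gtr0_norm//.
have tx : t * `|x| < e.
  by move: te; rewrite ltr_pdivlMr//; apply: le_lt_trans; rewrite ler_pM2l// lerDl.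
move=> /(_ tx); rewrite exprMn mulrCA [X in _ <= X]mulrC; apply: le_trans.
rewrite (le_trans _ (coord_le_norm _ a 0))// summxE le_eqVlt; apply/orP; left.
by apply/eqP; congr (`| _ |); apply: eq_bigr => i _; rewrite hc mxE mulrC.
Qed.

Lemma taylor_part_homogeneous (A : set V) p (F : V -> 'cV[R]_p) :
  open A -> A 0 -> smooth_on A F ->
  forall k t x, taylor_part k F (t *: x) = t ^+ k *: taylor_part k F x.
Proof.
move=> oA A0 sF k t x.
have main y : A y -> iter_derive (nseq k (t *: x)) F y = t ^+ k *: iter_derive (nseq k x) F y.
  elim: k y => [|k IHk] y Ay; first by rewrite expr0 scale1r.
  have dx : differentiable (iter_derive (nseq k x) F) y by exact: sF.
  have -> : iter_derive (nseq k.+1 (t *: x)) F y =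
      'D_(t *: x) (t ^+ k *: iter_derive (nseq k x) F) y.
    apply: near_eq_derive; apply: filterS (open_nbhs_nbhs (conj oA Ay)) => z Az.
    exact: IHk.
  rewrite deriveZ; last exact: diff_derivable.
  by rewrite deriveE// linearZ /= -deriveE// scalerA exprSr.
by rewrite /taylor_part main// !scalerA mulrC.
Qed.

End VanishingOrder.

(** * Composition of the two series *)

Section SeriesInversion.
Variables (R : realType) (n : nat).
Local Notation V := 'cV[R]_n.

Lemma sum_convolution (W : nmodType) N (f : nat -> nat -> W) :
  \sum_(m < N) \sum_(i < m.+1 | (0 < i)%N) f i (m - i)%N =
  \sum_(i < N | (0 < i)%N) \sum_(q < N | (i + q < N)%N) f i q.
Proof.
transitivity (\sum_(m < N) \sum_(i < N | (0 < i)%N && (i <= m)%N) f i (m - i)%N).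
  apply: eq_bigr => m _.
  by rewrite (big_ord_widen_cond N (fun i => (0 < i)%N) (fun i => f i (m - i)%N)).
rewrite (exchange_big_dep (fun i : 'I_N => (0 < i)%N)) /=; last first.
  by move=> m i _ /andP[].
apply: eq_bigr => i i0.
rewrite (eq_bigl (fun m : 'I_N => (i <= m)%N)); last by move=> m; rewrite i0.
rewrite -(big_geq_mkord i N predT (fun m => f i (m - i)%N)) /=.
rewrite -{1}[nat_of_ord i]add0n big_addn.
under eq_bigr do rewrite addnK.
rewrite big_mkord (big_ord_widen_cond N predT (fun q => f i q) (leq_subr _ _)).
by apply: eq_bigl => q /=; rewrite ltn_subRL.
Qed.

Section Expansion.
Variables (T : forall k : nat, 'M[R]_(n, n ^ k)) (Phi : V -> V).
Hypothesis PhiT : forall N, vanishes_to_order N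
  (fun z => Phi z - \sum_(i < N | (0 < i)%N) T i *m kron_pow z i).

(** By induction on p, with a the truncation of Phi and K the p-th power of
    Phi: ktens Phi K differs from the sum of the ktens a_i (tensor_part p q),
    i + q < N, by ktens (Phi - a) K, by ktens of a and the error for p, and by
    the finitely many terms with i + q >= N, all of order N. *)
Lemma kron_pow_expansion N p : vanishes_to_order N
  (fun z => kron_pow (Phi z) p - \sum_(q < N) tensor_part T p q z).
Proof.
have Phi0 : vanishes_to_order 0 Phi.
  by apply: vanishes_eq (PhiT 0) => z; rewrite big_ord0 subr0.
have a0 : vanishes_to_order 0 (fun z => \sum_(i < N | (0 < i)%N) T i *m kron_pow z i).
  apply: vanishes_sum => i _; apply: vanishesW (leq0n i) _.
  exact: vanishes_mulmx (vanishes_kron_pow R n i).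
elim: p => [|p IHp].
  case: N {a0} => [|N].
    by apply: vanishes_eq (vanishes_kron_pow R n 0) => z; rewrite big_ord0 subr0 !kron_pow0.
  apply: vanishes_eq (vanishes0 R n N.+1 _) => z.
  rewrite big_ord_recl tensor_part00 kron_pow0 big1 ?addr0 ?subrr// => i _.
  exact: tensor_part0S.
have h1 := vanishes_ktens (PhiT N) (vanishes_kron_pow_comp p Phi0).
have h2 := vanishes_ktens a0 IHp.
rewrite addn0 in h1; rewrite add0n in h2.
have h3 : vanishes_to_order N (fun z => \sum_(i < N | (0 < i)%N)
    \sum_(q < N | (N <= i + q)%N) ktens (T i *m kron_pow z i) (tensor_part T p q z)).
  apply: vanishes_sum => i _; apply: vanishes_sum => q Nq.
  apply: vanishesW Nq _; apply: vanishes_ktens (vanishes_tensor_part T p q).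
  exact: vanishes_mulmx (vanishes_kron_pow R n i).
apply: vanishes_eq (vanishesD h1 (vanishesD h2 h3)) => z /=.
set a := \sum_(i < N | _) _.
rewrite kron_powS ktensBl ktensBr.
have -> : \sum_(q < N) tensor_part T p.+1 q z =
    \sum_(i < N | (0 < i)%N) \sum_(q < N | (i + q < N)%N)
      ktens (T i *m kron_pow z i) (tensor_part T p q z).
  under eq_bigr do rewrite tensor_partS.
  exact: (sum_convolution N (fun i q => ktens (T i *m kron_pow z i) (tensor_part T p q z))).
have -> : ktens a (\sum_(q < N) tensor_part T p q z) =
    \sum_(i < N | (0 < i)%N) \sum_(q < N | (i + q < N)%N)
      ktens (T i *m kron_pow z i) (tensor_part T p q z) +
    \sum_(i < N | (0 < i)%N) \sum_(q < N | (N <= i + q)%N)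
      ktens (T i *m kron_pow z i) (tensor_part T p q z).
  rewrite ktens_suml -big_split /=; apply: eq_bigr => i _.
  rewrite ktens_sumr (bigID (fun q : 'I_N => (i + q < N)%N)) /=; congr (_ + _).
  by apply: eq_bigl => q; rewrite -leqNgt.
by rewrite opprD (addrA (ktens a (kron_pow (Phi z) p))) subrK subrKA.
Qed.

(** Expand each power of Phi and exchange the sums over j and q: the coefficient
    of degree q is computed by inverse_coefficients_tensor_part, since the terms
    j > q vanish. *)
Lemma left_inverse_series (P : forall k : nat, 'M[R]_(n, n ^ k)) N :
  (T 1%N : 'M[R]_n) \in unitmx -> inverse_coefficients T P -> (1 < N)%N ->
  vanishes_to_order N
    (fun z => \sum_(j < N | (0 < j)%N) P j *m kron_pow (Phi z) j - z).
Proof.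
move=> uT TP N1.
have h : vanishes_to_order N (fun z => \sum_(j < N | (0 < j)%N)
    P j *m (kron_pow (Phi z) j - \sum_(q < N) tensor_part T j q z)).
  by apply: vanishes_sum => j _; apply: vanishes_mulmx; exact: kron_pow_expansion.
apply: vanishes_eq h => z.
under eq_bigr do rewrite mulmxBr mulmx_sumr.
rewrite sumrB; congr (_ - _).
rewrite (exchange_big_dep predT)//=.
rewrite (eq_bigr (fun q : 'I_N => if q == Ordinal N1 then z else 0)).
  by rewrite -big_mkcond big_pred1_eq.
move=> q _.
have -> : (q == Ordinal N1) = (q == 1%N :> nat) by [].
under eq_bigl do rewrite andbT.
case: (posnP q) => [q0|q0].
  by rewrite q0 /= big1// => j j0; rewrite tensor_part_lt ?mulmx0.
rewrite -(inverse_coefficients_tensor_part z uT TP q0).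
rewrite -(big_geq_mkord 1 N predT (fun j => P j *m tensor_part T j q z)) /=.
rewrite (@big_cat_nat _ _ _ q.+1)//= [X in _ + X]big1_seq ?addr0// => j.
by rewrite mem_index_iota => /andP[_ /andP[qj _]]; rewrite tensor_part_lt ?mulmx0.
Qed.

End Expansion.

Lemma taylor_part0 p (F : V -> 'cV[R]_p) x : taylor_part 0 F x = F 0.
Proof. by rewrite /taylor_part fact0 invr1 scale1r. Qed.

(** Substituting z = Psi y in left_inverse_series turns it into an expansion of
    Psi, because Phi (Psi y) = y and |Psi y| = O(|y|).  It has the same
    homogeneous parts as the Taylor expansion of Psi. *)
Lemma inverse_approximated_by (Phi Psi : V -> V) (U W : set V)
    (T P : forall k : nat, 'M[R]_(n, n ^ k)) :
  approximated_by Phi T -> (T 1%N : 'M[R]_n) \in unitmx ->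
  inverse_coefficients T P -> local_inverse Phi Psi U W ->
  approximated_by Psi P.
Proof.
move=> [_ Phi0 TT] uT TP inv.
have [[oU U0] [oW W0] [sPhi uPhi] UP WP] := inv.
have sPsi := inverse_smooth inv.
have Psi0 : Psi 0 = 0 by have [_] := UP _ U0; rewrite Phi0.
have PhiT N : vanishes_to_order N
    (fun z => Phi z - \sum_(i < N | (0 < i)%N) T i *m kron_pow z i).
  apply: vanishes_eq (taylor_remainder N oU U0 sPhi) => z; congr (_ - _).
  rewrite [RHS]big_mkcond; apply: eq_bigr => -[[|k] kN] _ /=.
    by rewrite taylor_part0.
  by rewrite TT.
split=> //.
  by apply: filterS (open_nbhs_nbhs (conj oW W0)) => y Wy; exact: sPsi.
move=> k x k0.
(* Beyond k, so that degree k is compared, and at least 2, so that degree 1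
   is part of the truncation of z. *)
pose N := k.+2.
pose c j (y : V) : V :=
  (if (0 < j)%N then P j *m kron_pow y j else 0) - taylor_part j Psi y.
have [C C0 CP] := inverse_lipschitz inv W0.
have PsiC : \forall y \near (0 : V), `|Psi y| <= C * `|y|.
  by apply: filterS CP => y; rewrite Psi0 !subr0.
have N1 : (1 < N)%N by [].
have h1 := vanishes_comp (ltW C0) PsiC (left_inverse_series PhiT uT TP N1).
have h2 := taylor_remainder N oW W0 sPsi.
have h3 : vanishes_to_order N (fun y => \sum_(j < N) c j y).
  have [D D0 DP] := vanishesD h1 h2; exists D => //.
  move: DP (open_nbhs_nbhs (conj oW W0)); apply: filterS2 => y h Wy.
  move: h; rewrite /=; have [_ ->] := WP _ Wy.
  by rewrite addrA subrK [X in X - _]big_mkcond -sumrB.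
apply/esym/eqP; rewrite -subr_eq0; apply/eqP.
have := @homogeneous_parts_unique R n N n c _ h3 k x.
rewrite /c k0; apply; last by rewrite /N.
move=> j t y; rewrite (taylor_part_homogeneous oW W0 sPsi) scalerBr; congr (_ - _).
by case: ifP => _; rewrite ?scaler0// kron_powZ scalemxAr.
Qed.

End SeriesInversion.

Unset Implicit Arguments.

Theorem theorem3p3 (R : realType) (n m p : nat) (S : control_affine R n m p)
    (Ec Eo : 'cV[R]_n -> R) (Phi : 'cV[R]_n -> 'cV[R]_n)
    (T P : forall k : nat, 'M[R]_(n, n ^ k))
    (hS : standing_assumptions S)
    (hE : energy_functions S Ec Eo)
    (hPhi : balancing_transformation Ec Eo Phi)
    (hT : approximated_by Phi T)
    (hT1 : (T 1%N : 'M[R]_n) \in unitmx)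
    (hP : inverse_coefficients T P) :
  (exists Psi U V, local_inverse Phi Psi U V) /\
  forall (Psi : 'cV[R]_n -> 'cV[R]_n) (U V : set 'cV[R]_n),
    local_inverse Phi Psi U V ->
    (forall x0 : 'cV[R]_n, V x0 ->
       forall (tf : R) (u : R -> 'cV[R]_m) (z : R -> 'cV[R]_n),
         0 < tf -> (forall t, `[0, tf]%classic t -> U (z t)) ->
         (trajectory S `[0, tf] u (Phi \o z) /\ Phi (z 0) = x0
          <-> trajectory (balanced_realization S Phi) `[0, tf] u z
              /\ z 0 = Psi x0)) /\
    approximated_by Psi P.
Proof.
have [sPhi Phi0 uPhi _] := hPhi.
split; first exact: local_inverse_exists.
move=> Psi U V inv; split; last exact: inverse_approximated_by hT hT1 hP inv.
by move=> x0 Vx0 tf u z tf0 zU; exact: (@trajectory_balanced R n m p S Phi Psi U V).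
Qed.
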